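(* Let $U=\begin{bmatrix} c_{RR} & c_{LR}\\ c_{RL} & c_{LL}\end{bmatrix}\in \mathrm{U}(2)$ with $c_{RR}\neq0$, let $\gamma,\delta\in\mathbb{R}$, and let $X_t^{(II)}$ be the Type II quantum walk with coin $U$, reflection phase $\gamma$ and initial state $\Psi_0^{(II)}=e^{i\delta}|0,L\rangle$. Put $b=\overline{c_{LR}}\,\Delta\, e^{-i\gamma}$, $\rho=\sqrt{1-|b|^2}$, $\nu^{(II)}(b)=\rho/|1+b|$ and $$M(b)=\bigl\{1+\mathrm{sgn}(|b|^2+\mathrm{Re}(b))\bigr\}\left|\frac{|b|^2+\mathrm{Re}(b)}{(1+b)^2}\right|.$$ Then for every $x\in\{0,1,2,\dots\}$, as $t\to\infty$, $$P(X_t^{(II)}=x)-\frac{1+(-1)^{x+t}}{2}\times\begin{cases}|M(b)|^2, & x=0,\\ |M(b)|^2\bigl(1+\nu^{(II)}(b)^{-2}\bigr)\,\nu^{(II)}(b)^{2x}, & x>0,\end{cases}\ \longrightarrow\ 0.$$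
   Context: For the coin $U$: $\Delta=\det U$; $\mathrm{sgn}(x)=1,0,-1$ for $x>0,x=0,x<0$. Type II quantum walk: the Hilbert space $\mathcal{H}^{(II)}$ has orthonormal basis $\{|0,L\rangle\}\cup\{|x,R\rangle,|x,L\rangle: x\ge1\}$; the unitary evolution $W^{(II,U)}$ is defined by $W|0,L\rangle=e^{i\gamma}|1,R\rangle$ and, for $x\ge1$, $W|x,R\rangle=c_{RR}|x+1,R\rangle+c_{LR}|x-1,L\rangle$, $W|x,L\rangle=c_{RL}|x+1,R\rangle+c_{LL}|x-1,L\rangle$ (with $|0,L\rangle$ as $|x-1,L\rangle$ when $x=1$). $P(X_t^{(II)}=x)=\sum_e|\langle e,(W^{(II,U)})^t\Psi_0^{(II)}\rangle|^2$, summed over basis vectors $e$ at position $x$ (only $|0,L\rangle$ for $x=0$; $|x,R\rangle,|x,L\rangle$ for $x\ge1$). *)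

(* Defs.v *)
From Stdlib Require Import Reals Lra.
Open Scope R_scope.

Definition Cx : Type := (R * R)%type.
Definition Cre (z : Cx) : R := fst z.
Definition Cim (z : Cx) : R := snd z.
Definition RtoC (r : R) : Cx := (r, 0).
Definition C0 : Cx := (0, 0).
Definition C1 : Cx := (1, 0).
Definition Cadd (z w : Cx) : Cx := (fst z + fst w, snd z + snd w).
Definition Copp (z : Cx) : Cx := (- fst z, - snd z).
Definition Csub (z w : Cx) : Cx := Cadd z (Copp w).
Definition Cmul (z w : Cx) : Cx :=
  (fst z * fst w - snd z * snd w, fst z * snd w + snd z * fst w).
Definition Cconj (z : Cx) : Cx := (fst z, - snd z).
Definition Cnorm2 (z : Cx) : R := fst z * fst z + snd z * snd z.
Definition Cmod (z : Cx) : R := sqrt (Cnorm2 z).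
Definition Cinv (z : Cx) : Cx := (fst z / Cnorm2 z, - snd z / Cnorm2 z).
Definition Cdiv (z w : Cx) : Cx := Cmul z (Cinv w).
Definition Cexpi (theta : R) : Cx := (cos theta, sin theta).

Definition unitary2 (cRR cLR cRL cLL : Cx) : Prop :=
  Cadd (Cmul (Cconj cRR) cRR) (Cmul (Cconj cRL) cRL) = C1 /\
  Cadd (Cmul (Cconj cLR) cLR) (Cmul (Cconj cLL) cLL) = C1 /\
  Cadd (Cmul (Cconj cRR) cLR) (Cmul (Cconj cRL) cLL) = C0 /\
  Cadd (Cmul cRR (Cconj cRR)) (Cmul cLR (Cconj cLR)) = C1 /\
  Cadd (Cmul cRL (Cconj cRL)) (Cmul cLL (Cconj cLL)) = C1 /\
  Cadd (Cmul cRR (Cconj cRL)) (Cmul cLR (Cconj cLL)) = C0.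

Definition detU (cRR cLR cRL cLL : Cx) : Cx := Csub (Cmul cRR cLL) (Cmul cLR cRL).

Definition sgn (x : R) : R :=
  match Rlt_dec 0 x with
  | left _ => 1
  | right _ => match Rlt_dec x 0 with left _ => -1 | right _ => 0 end
  end.

(* A state of H^(II) is a pair (psiR, psiL) of amplitude functions on nat:
   psiL x = <x,L|psi> (x >= 0), psiR x = <x,R|psi> (x >= 1); psiR 0 is
   unused (the basis has no |0,R>) and is kept equal to 0. *)
Definition state : Type := ((nat -> Cx) * (nat -> Cx))%type.

(* One application of W^(II,U) with reflection phase gamma:
   W|0,L> = e^{i gamma}|1,R>,
   W|x,R> = cRR|x+1,R> + cLR|x-1,L>,  W|x,L> = cRL|x+1,R> + cLL|x-1,L>  (x>=1). *)
Definition stepII (cRR cLR cRL cLL : Cx) (gamma : R) (psi : state) : state :=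
  let (pR, pL) := psi in
  ( fun y => match y with
             | O => C0
             | S O => Cmul (Cexpi gamma) (pL O)
             | S y' => Cadd (Cmul cRR (pR y')) (Cmul cRL (pL y'))
             end,
    fun y => Cadd (Cmul cLR (pR (S y))) (Cmul cLL (pL (S y))) ).

Definition psi0II (delta : R) : state :=
  (fun _ => C0, fun y => match y with O => Cexpi delta | S _ => C0 end).

Definition psiII (cRR cLR cRL cLL : Cx) (gamma delta : R) (t : nat) : state :=
  Nat.iter t (stepII cRR cLR cRL cLL gamma) (psi0II delta).

Definition probII (cRR cLR cRL cLL : Cx) (gamma delta : R) (t x : nat) : R :=
  let (pR, pL) := psiII cRR cLR cRL cLL gamma delta t in
  match x with
  | O => Cnorm2 (pL O)
  | S _ => Cnorm2 (pR x) + Cnorm2 (pL x)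
  end.

Definition bII (cRR cLR cRL cLL : Cx) (gamma : R) : Cx :=
  Cmul (Cmul (Cconj cLR) (detU cRR cLR cRL cLL)) (Cexpi (- gamma)).

Definition rho (b : Cx) : R := sqrt (1 - Cnorm2 b).

Definition nuII (b : Cx) : R := rho b / Cmod (Cadd C1 b).

Definition Mb (b : Cx) : R :=
  let s := Cnorm2 b + Cre b in
  (1 + sgn s) * Cmod (Cdiv (RtoC s) (Cmul (Cadd C1 b) (Cadd C1 b))).

Definition limII (b : Cx) (t x : nat) : R :=
  (1 + (-1) ^ (x + t)) / 2 *
  match x with
  | O => (Rabs (Mb b)) ^ 2
  | S _ => (Rabs (Mb b)) ^ 2 * (1 + / (nuII b ^ 2)) * nuII b ^ (2 * x)
  end.

(* Main.v *)
From Stdlib Require Import Reals Lra Lia FunctionalExtensionality.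
From Coquelicot Require Import Rcomplements Rbar Hierarchy Lim_seq Series.
(* Imported last: [Reals] also defines a [C1]. *)
Require Import Defs.
Open Scope R_scope.

(** Let [L_x], [R_x] be the generating functions in time of the amplitudes at
    site [x]. The Wronskian [R_x L_(x+1) - L_x R_(x+1)] is geometric in [x], and
    finite propagation speed makes its low-order coefficients vanish for large
    [x], so it is zero; at [x = 1] this is a quadratic equation for [L_0]. Solving
    it in [u = Delta z^2], up to the phase of the initial state,
      [L_0 = (1 + 2 b - u + sqrt D) / (2 ((1 + b) - u (1 + conj b)))],
      [D = 1 - 2 (1 - 2 |b|^2) u + u^2].
    The coefficients of [sqrt D] satisfy a three-term recurrence and decay like
    [n^(-3/2)], hence are summable, so the return amplitudes are governed by the
    pole [u0 = (1 + b) / (1 + conj b)]. There [sqrt D = 2 |s| / (1 + conj b)] with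
    [s = |b|^2 + Re b]: the square is explicit, and the sign is found by following
    the root along the radius to [u0]. The numerator at the pole is thus a multiple
    of [s + |s|]. The step relations of the walk then carry the asymptotics from the
    origin to every site. *)

(** * Arithmetic of complex numbers as pairs of reals *)

Lemma Cx_ring : ring_theory C0 C1 Cadd Cmul Csub Copp (@eq Cx).
Proof.
  split; intros;
    repeat match goal with z : Cx |- _ => destruct z end;
    unfold Csub, Cadd, Cmul, Copp, C0, C1; simpl; try f_equal; ring.
Qed.

Add Ring Cx_ring_inst : Cx_ring.

Ltac Ccomp :=
  repeat match goal with z : Cx |- _ => destruct z as [? ?] end;
  unfold Cdiv, Cinv, Csub, Cadd, Cmul, Copp, Cconj, Cnorm2, RtoC, C0, C1 in *;
  cbn [fst snd] in *.

Lemma Cnorm2_mul (z w : Cx) : Cnorm2 (Cmul z w) = Cnorm2 z * Cnorm2 w.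
Proof. Ccomp; ring. Qed.

Lemma Cconj_mul (z w : Cx) : Cconj (Cmul z w) = Cmul (Cconj z) (Cconj w).
Proof. Ccomp; f_equal; ring. Qed.

Lemma Cmul_conj (z : Cx) : Cmul z (Cconj z) = RtoC (Cnorm2 z).
Proof. Ccomp; f_equal; ring. Qed.

Lemma Cnorm2_conj (z : Cx) : Cnorm2 (Cconj z) = Cnorm2 z.
Proof. Ccomp; ring. Qed.

Lemma Cnorm2_nonneg (z : Cx) : 0 <= Cnorm2 z.
Proof. Ccomp; nra. Qed.

Lemma Cnorm2_eq0 (z : Cx) : Cnorm2 z = 0 -> z = C0.
Proof. Ccomp; intro H; f_equal; nra. Qed.

Lemma Cmul_inv_r (z : Cx) : Cnorm2 z <> 0 -> Cmul z (Cinv z) = C1.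
Proof. Ccomp; intro H; f_equal; field; exact H. Qed.

Lemma Cmul_cancel_l (a z w : Cx) :
  Cnorm2 a <> 0 -> Cmul a z = Cmul a w -> z = w.
Proof.
  intros Ha H.
  transitivity (Cmul (Cinv a) (Cmul a z)).
  - transitivity (Cmul (Cmul a (Cinv a)) z); [rewrite Cmul_inv_r by exact Ha|]; ring.
  - rewrite H.
    transitivity (Cmul (Cmul a (Cinv a)) w); [|rewrite Cmul_inv_r by exact Ha]; ring.
Qed.

Lemma Cnorm2_Cexpi (theta : R) : Cnorm2 (Cexpi theta) = 1.
Proof.
  unfold Cnorm2, Cexpi; simpl. pose proof (sin2_cos2 theta) as H.
  unfold Rsqr in H; lra.
Qed.

Fixpoint Cpow (z : Cx) (n : nat) : Cx :=
  match n with O => C1 | S m => Cmul z (Cpow z m) end.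

Lemma Cnorm2_pow (z : Cx) (n : nat) : Cnorm2 (Cpow z n) = Cnorm2 z ^ n.
Proof.
  induction n as [|n IH]; simpl; [unfold Cnorm2, C1; simpl; ring|].
  now rewrite Cnorm2_mul, IH.
Qed.

Lemma Cpow_mul (z w : Cx) (n : nat) : Cpow (Cmul z w) n = Cmul (Cpow z n) (Cpow w n).
Proof. induction n as [|n IH]; simpl; [|rewrite IH]; ring. Qed.

(** * Formal power series *)

Definition ps : Type := nat -> Cx.

Definition ps_tail (a : ps) : ps := fun n => a (S n).
Definition ps_add (a b : ps) : ps := fun n => Cadd (a n) (b n).
Definition ps_opp (a : ps) : ps := fun n => Copp (a n).
Definition ps_sub (a b : ps) : ps := fun n => Csub (a n) (b n).
Definition ps_const (c : Cx) : ps := fun n => match n with O => c | S _ => C0 end.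
Definition ps_X : ps := fun n => match n with S O => C1 | _ => C0 end.

(* Cauchy product, through [a b = a_0 b + X (tail a) b]. *)
Fixpoint ps_conv (n : nat) (a b : ps) : Cx :=
  match n with
  | O => Cmul (a O) (b O)
  | S m => Cadd (Cmul (a O) (b n)) (ps_conv m (ps_tail a) b)
  end.

Definition ps_mul (a b : ps) : ps := fun n => ps_conv n a b.

Declare Scope ps_scope.
Delimit Scope ps_scope with ps.
Local Notation "a + b" := (ps_add a b) : ps_scope.
Local Notation "a - b" := (ps_sub a b) : ps_scope.
Local Notation "a * b" := (ps_mul a b) : ps_scope.
Local Notation "# c" := (ps_const c) (at level 5, format "# c") : ps_scope.

Lemma ps_conv_add_l (n : nat) (a b c : ps) :
  ps_conv n (ps_add a b) c = Cadd (ps_conv n a c) (ps_conv n b c).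
Proof.
  revert a b; induction n as [|n IH]; intros a b; simpl.
  - unfold ps_add; ring.
  - change (ps_tail (ps_add a b)) with (ps_add (ps_tail a) (ps_tail b)).
    rewrite IH; unfold ps_add; ring.
Qed.

Lemma ps_conv_scal_l (n : nat) (k : Cx) (a b : ps) :
  ps_conv n (fun i => Cmul k (a i)) b = Cmul k (ps_conv n a b).
Proof.
  revert a; induction n as [|n IH]; intros a; simpl; [ring|].
  change (ps_tail (fun i => Cmul k (a i))) with (fun i => Cmul k (ps_tail a i)).
  rewrite IH; ring.
Qed.

Lemma ps_conv_zero (n : nat) (a b : ps) :
  (forall k, (k <= n)%nat -> a k = C0) -> ps_conv n a b = C0.
Proof.
  revert a; induction n as [|n IH]; intros a H; simpl; rewrite (H O) by lia; [ring|].
  rewrite IH by (intros k Hk; apply H; lia); ring.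
Qed.

(** Peeling the heads of both factors leaves the product of the two tails, two degrees lower; hence
    the strong induction. *)
Lemma ps_conv_comm (n : nat) (a b : ps) : ps_conv n a b = ps_conv n b a.
Proof.
  revert a b; induction n as [n IH] using (well_founded_induction Wf_nat.lt_wf); intros a b.
  destruct n as [|n]; cbn [ps_conv]; [ring|].
  rewrite (IH n ltac:(lia) (ps_tail a) b), (IH n ltac:(lia) (ps_tail b) a).
  destruct n as [|n]; cbn [ps_conv]; [unfold ps_tail; ring|].
  rewrite (IH n ltac:(lia) (ps_tail a) (ps_tail b)); unfold ps_tail; ring.
Qed.

(** The tail of [a b] is [a_0 (tail b) + (tail a) b], so induction and linearity in the left factor
    suffice. *)
Lemma ps_conv_assoc (n : nat) (a b c : ps) :
  ps_conv n a (ps_mul b c) = ps_conv n (ps_mul a b) c.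
Proof.
  revert a b; induction n as [|n IH]; intros a b; simpl; [unfold ps_mul; simpl; ring|].
  rewrite IH.
  replace (ps_tail (ps_mul a b))
    with (ps_add (fun i => Cmul (a O) (ps_tail b i)) (ps_mul (ps_tail a) b))
    by reflexivity.
  rewrite ps_conv_add_l, ps_conv_scal_l; unfold ps_mul; simpl; ring.
Qed.

Lemma ps_const_mul (c : Cx) (a : ps) (n : nat) :
  ps_mul (ps_const c) a n = Cmul c (a n).
Proof.
  unfold ps_mul; destruct n as [|n]; simpl; [reflexivity|].
  rewrite ps_conv_zero by reflexivity; ring.
Qed.

Lemma ps_X_mul_0 (a : ps) : ps_mul ps_X a O = C0.
Proof. unfold ps_mul; simpl; ring. Qed.

Lemma ps_X_mul_S (a : ps) (n : nat) : ps_mul ps_X a (S n) = a n.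
Proof.
  unfold ps_mul; simpl. change (ps_tail ps_X) with (ps_const C1).
  fold (ps_mul (ps_const C1) a n); rewrite ps_const_mul; ring.
Qed.

Lemma ps_X_mul_inj (a b : ps) : ps_mul ps_X a = ps_mul ps_X b -> a = b.
Proof.
  intro H; apply functional_extensionality; intro n.
  now rewrite <- (ps_X_mul_S a), H, ps_X_mul_S.
Qed.

Lemma ps_ring :
  ring_theory (ps_const C0) (ps_const C1) ps_add ps_mul ps_sub ps_opp (@eq ps).
Proof.
  split; intros; apply functional_extensionality; intro n.
  - unfold ps_add; destruct n; simpl; ring.
  - unfold ps_add; ring.
  - unfold ps_add; ring.
  - rewrite ps_const_mul; ring.
  - apply ps_conv_comm.
  - apply ps_conv_assoc.
  - apply ps_conv_add_l.
  - unfold ps_sub, ps_add, ps_opp; ring.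
  - unfold ps_add, ps_opp; destruct n; simpl; ring.
Qed.

Add Ring ps_ring_inst : ps_ring.

Lemma ps_const_Cadd (c d : Cx) : ps_const (Cadd c d) = ps_add (ps_const c) (ps_const d).
Proof. apply functional_extensionality; intros [|n]; unfold ps_add; simpl; ring. Qed.

Lemma ps_const_Csub (c d : Cx) : ps_const (Csub c d) = ps_sub (ps_const c) (ps_const d).
Proof. apply functional_extensionality; intros [|n]; unfold ps_sub; simpl; ring. Qed.

Lemma ps_const_Copp (c : Cx) : ps_const (Copp c) = ps_opp (ps_const c).
Proof. apply functional_extensionality; intros [|n]; unfold ps_opp; simpl; ring. Qed.

Lemma ps_const_Cmul (c d : Cx) : ps_const (Cmul c d) = ps_mul (ps_const c) (ps_const d).
Proof.
  apply functional_extensionality; intros n; rewrite ps_const_mul.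
  destruct n; simpl; ring.
Qed.

Lemma ps_const_mul_cancel (c : Cx) (a b : ps) :
  Cnorm2 c <> 0 -> ps_mul (ps_const c) a = ps_mul (ps_const c) b -> a = b.
Proof.
  intros Hc H; apply functional_extensionality; intro n.
  apply (Cmul_cancel_l c); [exact Hc|]. now rewrite <- !ps_const_mul, H.
Qed.

(** * Euler operator and substitutions in the variable *)

Definition ps_theta (a : ps) : ps := fun n => Cmul (RtoC (INR n)) (a n).

(** Leibniz rule for [X d/dX]. Taking a tail lowers the weight by one, which produces the extra
    summand [ps_tail a] in the induction. *)
Lemma ps_theta_mul (a b : ps) :
  ps_theta (ps_mul a b) = ps_add (ps_mul (ps_theta a) b) (ps_mul a (ps_theta b)).
Proof.
  apply functional_extensionality; intro n; unfold ps_mul, ps_add.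
  unfold ps_theta at 1.
  revert a; induction n as [|n IH]; intro a.
  - simpl; unfold ps_theta; simpl; unfold RtoC; fold C0; ring.
  - cbn [ps_conv].
    replace (ps_tail (ps_theta a)) with (ps_add (ps_theta (ps_tail a)) (ps_tail a)).
    + rewrite ps_conv_add_l.
      transitivity (Cadd (Cmul (RtoC (INR (S n))) (Cmul (a O) (b (S n))))
        (Cadd (Cmul (RtoC (INR n)) (ps_conv n (ps_tail a) b)) (ps_conv n (ps_tail a) b))).
      * rewrite S_INR; generalize (ps_conv n (ps_tail a) b), (a O), (b (S n)), (INR n).
        intros; Ccomp; f_equal; ring.
      * rewrite IH; unfold ps_theta; change (RtoC (INR 0)) with C0; ring.
    + apply functional_extensionality; intro k; unfold ps_add, ps_theta, ps_tail.
      rewrite S_INR; generalize (a (S k)), (INR k); intros; Ccomp; f_equal; ring.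
Qed.

(* For [a] even, the series [n |-> q^n a_(2n)] is [a] read in the variable [X^2 / q]. *)
Definition ps_even (q : Cx) (a : ps) : ps := fun n => Cmul (Cpow q n) (a (2 * n)%nat).

Lemma ps_even_mul (q : Cx) (a b : ps) :
  (forall n, a (S (2 * n)) = C0) ->
  ps_even q (ps_mul a b) = ps_mul (ps_even q a) (ps_even q b).
Proof.
  intro Ha; apply functional_extensionality; intro n; unfold ps_mul.
  revert a Ha; unfold ps_even at 1; induction n as [|n IH]; intros a Ha.
  - simpl; unfold ps_even; simpl; ring.
  - replace (2 * S n)%nat with (S (S (2 * n))) by lia.
    cbn [ps_conv]. change (ps_tail a O) with (a (S (2 * 0))); rewrite Ha.
    assert (HT : ps_tail (ps_even q a) = fun i => Cmul q (ps_even q (ps_tail (ps_tail a)) i)).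
    { apply functional_extensionality; intro i; unfold ps_tail, ps_even.
      replace (2 * S i)%nat with (S (S (2 * i))) by lia. simpl Cpow; ring. }
    rewrite HT, ps_conv_scal_l, <- IH.
    + unfold ps_even. replace (2 * S n)%nat with (S (S (2 * n))) by lia. simpl Cpow. simpl (2 * 0)%nat. simpl Cpow. ring.
    + intro k; unfold ps_tail. replace (S (S (S (2 * k)))) with (S (2 * S k)) by lia. apply Ha.
Qed.

(** Substituting [y X] for [X] respects products; this turns an identity [F * F = D] into one
    between values at [y]. *)
Lemma ps_conv_geom (y : Cx) (n : nat) (a b : ps) :
  ps_conv n (fun k => Cmul (Cpow y k) (a k)) (fun k => Cmul (Cpow y k) (b k))
  = Cmul (Cpow y n) (ps_conv n a b).
Proof.
  revert a; induction n as [|n IH]; intro a; cbn [ps_conv]; [simpl; ring|].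
  replace (ps_tail (fun k => Cmul (Cpow y k) (a k)))
    with (fun k => Cmul y (Cmul (Cpow y k) (ps_tail a k))).
  - rewrite ps_conv_scal_l, IH; simpl; ring.
  - apply functional_extensionality; intro k; unfold ps_tail; simpl; ring.
Qed.

(** * The generating functions of the walk *)

(** Row orthogonality makes the second row a multiple of [(- conj cLR, conj cRR)]; the factor is the
    determinant, a phase. *)
Lemma unitary2_cols (cRR cLR cRL cLL : Cx) :
  unitary2 cRR cLR cRL cLL ->
  Cnorm2 cRR + Cnorm2 cLR = 1 /\
  Cnorm2 (detU cRR cLR cRL cLL) = 1 /\
  cRL = Copp (Cmul (detU cRR cLR cRL cLL) (Cconj cLR)) /\
  cLL = Cmul (detU cRR cLR cRL cLL) (Cconj cRR).
Proof.
  intros (_ & _ & _ & H4 & H5 & H6).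
  assert (H6' : Cadd (Cmul (Cconj cRR) cRL) (Cmul (Cconj cLR) cLL) = C0).
  { transitivity (Cconj (Cadd (Cmul cRR (Cconj cRL)) (Cmul cLR (Cconj cLL)))).
    - clear; Ccomp; f_equal; ring.
    - rewrite H6; unfold Cconj, C0; simpl; f_equal; ring. }
  assert (Hrow : Cnorm2 cRR + Cnorm2 cLR = 1).
  { rewrite !Cmul_conj in H4. apply (f_equal fst) in H4. exact H4. }
  (* [cRL] times the squared norm of the first row, minus [cRR] times the orthogonality relation,
     collapses to the determinant; [cLL] is treated likewise. *)
  assert (HRL : cRL = Copp (Cmul (detU cRR cLR cRL cLL) (Cconj cLR))).
  { transitivity (Csub (Cmul cRL (Cadd (Cmul cRR (Cconj cRR)) (Cmul cLR (Cconj cLR))))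
                   (Cmul cRR (Cadd (Cmul (Cconj cRR) cRL) (Cmul (Cconj cLR) cLL)))).
    - rewrite H4, H6'; ring.
    - unfold detU; ring. }
  assert (HLL : cLL = Cmul (detU cRR cLR cRL cLL) (Cconj cRR)).
  { transitivity (Csub (Cmul cLL (Cadd (Cmul cRR (Cconj cRR)) (Cmul cLR (Cconj cLR))))
                   (Cmul cLR (Cadd (Cmul (Cconj cRR) cRL) (Cmul (Cconj cLR) cLL)))).
    - rewrite H4, H6'; ring.
    - unfold detU; ring. }
  split; [exact Hrow|]; split; [|split; assumption].
  rewrite !Cmul_conj in H5; apply (f_equal fst) in H5; simpl in H5.
  assert (E1 := f_equal Cnorm2 HRL). assert (E2 := f_equal Cnorm2 HLL).
  replace (Copp (Cmul (detU cRR cLR cRL cLL) (Cconj cLR)))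
    with (Cmul (Copp C1) (Cmul (detU cRR cLR cRL cLL) (Cconj cLR))) in E1 by ring.
  rewrite (Cnorm2_mul (Copp C1)), Cnorm2_mul, Cnorm2_conj in E1.
  rewrite Cnorm2_mul, Cnorm2_conj in E2.
  replace (Cnorm2 (Copp C1)) with 1 in E1 by (unfold Cnorm2, C1; simpl; ring).
  rewrite E1, E2 in H5.
  transitivity (Cnorm2 (detU cRR cLR cRL cLL) * (Cnorm2 cRR + Cnorm2 cLR)).
  - rewrite Hrow; ring.
  - lra.
Qed.

Section Walk.

Variables (cRR cLR cRL cLL : Cx) (gamma delta : R).

Definition ampR (x : nat) : ps := fun t => fst (psiII cRR cLR cRL cLL gamma delta t) x.
Definition ampL (x : nat) : ps := fun t => snd (psiII cRR cLR cRL cLL gamma delta t) x.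

Lemma ampR_1_S (t : nat) : ampR 1 (S t) = Cmul (Cexpi gamma) (ampL 0 t).
Proof.
  unfold ampR, ampL, psiII; rewrite Nat.iter_succ.
  now destruct (Nat.iter t _ _) as [pR pL].
Qed.

Lemma ampR_SS_S (x t : nat) :
  ampR (S (S x)) (S t) = Cadd (Cmul cRR (ampR (S x) t)) (Cmul cRL (ampL (S x) t)).
Proof.
  unfold ampR, ampL, psiII; rewrite Nat.iter_succ.
  now destruct (Nat.iter t _ _) as [pR pL].
Qed.

Lemma ampL_S (x t : nat) :
  ampL x (S t) = Cadd (Cmul cLR (ampR (S x) t)) (Cmul cLL (ampL (S x) t)).
Proof.
  unfold ampR, ampL, psiII; rewrite Nat.iter_succ.
  now destruct (Nat.iter t _ _) as [pR pL].
Qed.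

Lemma ampR_0 (t : nat) : ampR 0 t = C0.
Proof.
  destruct t as [|t]; [reflexivity|].
  unfold ampR, psiII; rewrite Nat.iter_succ.
  now destruct (Nat.iter t _ _) as [pR pL].
Qed.

Lemma amp_light_cone (t x : nat) : (t < x)%nat -> ampR x t = C0 /\ ampL x t = C0.
Proof.
  revert x; induction t as [|t IH]; intros [|x] Hx; try lia; [now split|].
  destruct (IH (S (S x)) ltac:(lia)) as [HR HL].
  split; [|rewrite ampL_S, HR, HL; ring].
  destruct x as [|x]; [lia|].
  destruct (IH (S x) ltac:(lia)) as [HR' HL'].
  rewrite ampR_SS_S, HR', HL'; ring.
Qed.

(** Each step moves the walker by exactly one site, and it starts at the origin. *)
Lemma amp_parity (t x k : nat) : (t + x = S (2 * k))%nat -> ampR x t = C0 /\ ampL x t = C0.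
Proof.
  revert x k; induction t as [|t IH]; intros x k Hk.
  - destruct x as [|x]; [lia|now split].
  - split.
    + destruct x as [|[|x]]; [apply ampR_0| |].
      * destruct k as [|k]; [lia|]. rewrite ampR_1_S.
        destruct (IH O k ltac:(lia)) as [_ ->]; ring.
      * destruct k as [|k]; [lia|]. rewrite ampR_SS_S.
        destruct (IH (S x) k ltac:(lia)) as [-> ->]; ring.
    + rewrite ampL_S. destruct (IH (S x) k ltac:(lia)) as [-> ->]; ring.
Qed.

Local Open Scope ps_scope.

Lemma ampR_1_series : ampR 1 = ps_X * (#(Cexpi gamma) * ampL 0).
Proof.
  apply functional_extensionality; intros [|t]; [now rewrite ps_X_mul_0|].
  now rewrite ps_X_mul_S, ps_const_mul, ampR_1_S.
Qed.

Lemma ampR_SS_series (x : nat) :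
  ampR (S (S x)) = ps_X * (#cRR * ampR (S x) + #cRL * ampL (S x)).
Proof.
  apply functional_extensionality; intros [|t]; [now rewrite ps_X_mul_0|].
  rewrite ps_X_mul_S; unfold ps_add; now rewrite !ps_const_mul, ampR_SS_S.
Qed.

(** The constant term is the initial amplitude. It is nonzero only at the origin, where it becomes
    the inhomogeneity of the quadratic equation. *)
Lemma ampL_series (x : nat) :
  ampL x = #(ampL x O) + ps_X * (#cLR * ampR (S x) + #cLL * ampL (S x)).
Proof.
  apply functional_extensionality; intros [|t]; unfold ps_add.
  - rewrite ps_X_mul_0; simpl; ring.
  - rewrite ps_X_mul_S, !ps_const_mul, ampL_S; simpl; ring.
Qed.

(** Index [x] belongs to the sites [x + 1] and [x + 2], which avoids the origin, where the
    reflection rule replaces the coin. *)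
Definition wronskian (x : nat) : ps :=
  ampR (S x) * ampL (S (S x)) - ampL (S x) * ampR (S (S x)).

(** Multiplied by [X], both sides equal [R_(x+2) L_(x+2) - R_(x+3) L_(x+1)]: the terms in [cLR] and
    in [cRL] cancel by antisymmetry. *)
Lemma wronskian_step (x : nat) : #cLL * wronskian (S x) = #cRR * wronskian x.
Proof.
  apply ps_X_mul_inj; unfold wronskian.
  pose proof (ampR_SS_series x) as E1.
  pose proof (ampR_SS_series (S x)) as E2.
  pose proof (ampL_series (S x)) as E3.
  pose proof (ampL_series (S (S x))) as E4.
  change (ampL (S x) O) with C0 in E3. change (ampL (S (S x)) O) with C0 in E4.
  set (R1 := ampR (S x)) in *. set (R2 := ampR (S (S x))) in *.
  set (R3 := ampR (S (S (S x)))) in *. set (L1 := ampL (S x)) in *.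
  set (L2 := ampL (S (S x))) in *. set (L3 := ampL (S (S (S x)))) in *.
  transitivity (R2 * (#C0 + ps_X * (#cLR * R3 + #cLL * L3))
                - R3 * (#C0 + ps_X * (#cLR * R2 + #cLL * L2))); [ring|].
  rewrite <- E3, <- E4.
  transitivity ((ps_X * (#cRR * R1 + #cRL * L1)) * L2 - (ps_X * (#cRR * R2 + #cRL * L2)) * L1).
  - rewrite <- E1, <- E2; ring.
  - ring.
Qed.

(* The Wronskian is geometric in [x], yet its [m]-th coefficient vanishes once [x > m]. *)
Lemma wronskian_zero (x : nat) : Cnorm2 cRR <> 0%R -> wronskian x = #C0.
Proof.
  intro Hc; apply functional_extensionality; intro m.
  transitivity C0; [|destruct m; reflexivity].
  (* Downward induction on the site: [k] bounds how far [x] falls short of the light cone. *)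
  assert (H : forall k x, (m <= x + k)%nat -> wronskian x m = C0).
  { clear x; induction k as [|k IH]; intros x Hx.
    - unfold wronskian, ps_sub, ps_mul.
      rewrite !ps_conv_zero; [ring| |]; intros i Hi; apply amp_light_cone; lia.
    - apply (Cmul_cancel_l cRR); [exact Hc|].
      rewrite <- ps_const_mul, <- wronskian_step, ps_const_mul, IH by lia; ring. }
  apply (H m); lia.
Qed.

(** [bb] stands for the conjugate of [b]. The step relations and the reflection rule eliminate
    [R_1], [R_2], [L_1] and [L_2] from the vanishing Wronskian at sites 1 and 2. *)
Lemma ampL_0_quadratic (b bb Dl : Cx) :
  Cnorm2 cRR <> 0%R -> Cnorm2 cLL <> 0%R ->
  detU cRR cLR cRL cLL = Dl ->
  cRL = Copp (Cmul b (Cexpi gamma)) ->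
  Cmul cLR (Cexpi gamma) = Cmul Dl bb ->
  let w := #(Cexpi delta) in
  let A := ampL 0 in
  let u := #Dl * (ps_X * ps_X) in
  (#C1 - u) * A * (A - w) - u * #bb * A * A + #b * (A - w) * (A - w) = #C0.
Proof.
  intros HRR HLL HD Hb Hbb w A u.
  pose proof (wronskian_zero 0 HRR) as W; unfold wronskian in W.
  pose proof ampR_1_series as E1.
  pose proof (ampR_SS_series 0) as E2.
  pose proof (ampL_series 0) as E3. change (ampL 0 O) with (Cexpi delta) in E3.
  pose proof (ampL_series 1) as E4. change (ampL 1 O) with C0 in E4.
  fold w in E3; fold A in E1, E3.
  set (R1 := ampR 1) in *. set (R2 := ampR 2) in *.
  set (L1 := ampL 1) in *. set (L2 := ampL 2) in *.
  set (g := Cexpi gamma) in *.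
  assert (Hg : Cnorm2 g <> 0%R) by (unfold g; rewrite Cnorm2_Cexpi; lra).
  assert (Y : ps_X * #cLL * L1 = A - w - ps_X * #cLR * R1).
  { rewrite E3 at 1; ring. }
  (* The Wronskian times [X cLL]; the relation for [L_1] absorbs [L_2]. *)
  assert (F1 : R1 * L1 = R2 * (A - w)).
  { transitivity (R1 * L1 - (ps_X * #cLL) * #C0); [ring|].
    rewrite <- W.
    transitivity (R1 * L1 - R1 * (ps_X * #cLL * L2) + (ps_X * #cLL * L1) * R2); [ring|].
    rewrite Y.
    transitivity (R1 * L1 - R1 * (#C0 + ps_X * (#cLR * R2 + #cLL * L2)) + R2 * (A - w)); [ring|].
    rewrite <- E4; ring. }
  (* A second factor [X cLL] removes [L_1] and [R_2], and products of coin entries combine into the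
     determinant. *)
  assert (F2 : R1 * (A - w - ps_X * #cLR * R1)
               = ps_X * (ps_X * #Dl * R1 + #cRL * (A - w)) * (A - w)).
  { rewrite <- Y at 1. transitivity (ps_X * #cLL * (R1 * L1)); [ring|].
    rewrite F1, E2.
    transitivity (ps_X * (ps_X * #cLL * #cRR * R1 + #cRL * (ps_X * #cLL * L1)) * (A - w)); [ring|].
    rewrite Y, <- HD; unfold detU.
    rewrite ps_const_Csub, !ps_const_Cmul; ring. }
  (* Once [R_1 = X e^(i gamma) A] is inserted, [F2] is the claim times [X e^(i gamma)]. *)
  apply (ps_const_mul_cancel g); [exact Hg|].
  apply ps_X_mul_inj.
  transitivity (#C0); [|ring].
  transitivity (R1 * (A - w - ps_X * (#Dl * #bb) * (ps_X * A)) 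
      - ps_X * (ps_X * #Dl * R1 + ps_opp (#b * #g) * (A - w)) * (A - w)).
  - rewrite E1; unfold u; ring.
  - rewrite <- !ps_const_Cmul, <- ps_const_Copp, <- Hbb, <- Hb.
    rewrite ps_const_Cmul.
    transitivity (R1 * (A - w - ps_X * #cLR * (ps_X * (#g * A))) 
      - ps_X * (ps_X * #Dl * R1 + #cRL * (A - w)) * (A - w)); [ring|].
    rewrite <- E1, F2; ring.
Qed.

End Walk.

(** * Summability from a three-term recurrence *)

(* Raabe's test: the hypothesis makes [(n + 1) q_n - (n + 2) q_(n+1) >= q_n / 4]. *)
Lemma raabe_summable (q : nat -> R) (N : nat) :
  (forall n, 0 <= q n) ->
  (forall n, (N <= n)%nat -> (INR n + 2) * q (S n) <= (INR n + 3 / 4) * q n) ->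
  ex_series q.
Proof.
  intros Hq Hr.
  assert (Hs : ex_series (fun k => q (N + k)%nat)).
  { assert (Hb : forall k, sum_n (fun k => q (N + k)%nat) k
              <= 4 * ((INR N + 1) * q N - (INR (N + k) + 2) * q (S (N + k)))).
    { induction k as [|k IH].
      - rewrite sum_O, Nat.add_0_r. specialize (Hr N (le_n N)). lra.
      - rewrite sum_Sn; unfold plus; simpl.
        specialize (Hr (N + S k)%nat ltac:(lia)).
        rewrite Nat.add_succ_r in *. rewrite S_INR in *. lra. }
    apply (ex_finite_lim_seq_incr _ (4 * ((INR N + 1) * q N))).
    - intro k; rewrite sum_Sn; unfold plus; simpl. specialize (Hq (N + S k)%nat); lra.
    - intro k; specialize (Hb k); specialize (Hq (S (N + k))).
      pose proof (pos_INR (N + k)).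
      assert (0 <= (INR (N + k) + 2) * q (S (N + k))) by (apply Rmult_le_pos; lra).
      apply Rle_trans with (1 := Hb); lra. }
  destruct N as [|N]; [exact Hs|].
  apply (ex_series_incr_n q (S N)); exact Hs.
Qed.

(* The form [x^2 - p x y + q y^2] is multiplied by exactly [q = 1 - e] under
   [(x, y) |-> (p x - q y, x)]; with [e = 3 / (n + 2)] its square root decays
   like [n^(-3/2)]. *)
Lemma recurrence_summable (c : R) (d : nat -> R) :
  Rabs c < 1 ->
  (forall n, (INR n + 2) * d (S (S n)) = c * (2 * INR n + 1) * d (S n) - (INR n - 1) * d n) ->
  ex_series (fun n => Rabs (d n)).
Proof.
  intros Hc Hd.
  (* [|c| = 1 - 2 eta]: half of this gap absorbs the perturbation [e n], the other half keeps the
     form coercive with constant [eta]. *)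
  set (eta := (1 - Rabs c) / 2).
  assert (Heta : 0 < eta <= 1 / 2) by (pose proof (Rabs_pos c); unfold eta; lra).
  set (e := fun n => 3 / (INR n + 2)).
  set (Q := fun n (x y : R) => x * x - c * (2 - e n) * x * y + (1 - e n) * y * y).
  (* The threshold serves twice: it gives [e n <= eta], and it bounds the drift term
     [6 / (eta (n + 2))] by [1 / 2]. *)
  destruct (INR_unbounded (12 / eta)) as [N HN].
  assert (Hm : forall n, (N <= n)%nat -> 12 < eta * (INR n + 2)).
  { intros n Hn. apply le_INR in Hn.
    apply (Rmult_lt_compat_r eta) in HN; [|lra].
    unfold Rdiv in HN; rewrite Rmult_assoc, Rinv_l in HN by lra. nra. }
  assert (He : forall n, (N <= n)%nat -> 0 < e n <= eta).
  { intros n Hn; specialize (Hm n Hn); pose proof (pos_INR n).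
    unfold e; split; [apply Rdiv_lt_0_compat; lra|].
    apply Rle_div_l; lra. }
  assert (Hpos : forall n x y, (N <= n)%nat -> eta * (x * x + y * y) <= Q n x y).
  { intros n x y Hn; specialize (He n Hn); unfold Q.
    assert (H1 : c * (2 - e n) * x * y <= Rabs c * (x * x + y * y)).
    { apply Rle_trans with (Rabs (c * (2 - e n) * x * y)); [apply Rle_abs|].
      rewrite !Rabs_mult, (Rabs_pos_eq (2 - e n)) by lra.
      assert (H2 : 2 * (Rabs x * Rabs y) <= x * x + y * y).
      { pose proof (Rabs_pos x); pose proof (Rabs_pos y).
        assert (H3 := pow2_ge_0 (Rabs x - Rabs y)).
        assert (Hx := pow2_abs x); assert (Hy := pow2_abs y). nra. }
      pose proof (Rabs_pos c). 
      assert (0 <= Rabs x * Rabs y) by (apply Rmult_le_pos; apply Rabs_pos).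
      transitivity (Rabs c * (2 * (Rabs x * Rabs y))); [|apply Rmult_le_compat_l; lra].
      transitivity (Rabs c * ((2 - e n) * (Rabs x * Rabs y))); [right; ring|].
      apply Rmult_le_compat_l; [lra|]. apply Rmult_le_compat_r; lra. }
    assert (e n * (y * y) <= eta * (y * y)) by (apply Rmult_le_compat_r; nra).
    assert (Rabs c = 1 - 2 * eta) by (unfold eta; lra).
    nra. }
  set (S_ := fun n => Q n (d (S n)) (d n)).
  assert (HS0 : forall n, (N <= n)%nat -> 0 <= S_ n).
  { intros n Hn; unfold S_; specialize (Hpos n (d (S n)) (d n) Hn).
    assert (0 <= d (S n) * d (S n) + d n * d n) by nra. nra. }
  assert (Hinv : forall n, Q n (d (S (S n))) (d (S n)) = (1 - e n) * S_ n).
  { intro n; unfold S_, Q.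
    replace (d (S (S n))) with (c * (2 - e n) * d (S n) - (1 - e n) * d n).
    - ring.
    - pose proof (pos_INR n). apply (Rmult_eq_reg_l (INR n + 2)); [|lra].
      rewrite Hd; unfold e; field; lra. }
  (* The exact factor has 3 in place of [5 / 2]; the loss of [1 / 2] pays for the dependence of [Q]
     on [n]. Half of [5 / 2] still exceeds 1, and gives the [3 / 4] of Raabe's test. *)
  assert (Hstep : forall n, (N <= n)%nat ->
            S_ (S n) <= (1 - (5 / 2) / (INR n + 2)) * S_ n).
  { intros n Hn. pose proof (pos_INR n) as Hn0.
    specialize (Hm n Hn). pose proof (He n Hn) as Hen.
    assert (Hpn := Hpos n (d (S (S n))) (d (S n)) Hn). rewrite Hinv in Hpn.
    specialize (HS0 n Hn).
    set (x := d (S (S n))) in *. set (y := d (S n)) in *.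
    assert (Hdiff : S_ (S n) = (1 - e n) * S_ n + (e n - e (S n)) * (y * y - c * x * y)).
    { rewrite <- Hinv. unfold S_, Q; fold x y. ring. }
    assert (Hee : 0 <= e n - e (S n) <= 3 / (INR n + 2) / (INR n + 2)).
    { unfold e; rewrite S_INR.
      replace (3 / (INR n + 2) - 3 / (INR n + 1 + 2))
        with (3 / (INR n + 2) * / (INR n + 3)) by (field; lra).
      assert (0 < 3 / (INR n + 2)) by (apply Rdiv_lt_0_compat; lra).
      assert (0 < / (INR n + 3)) by (apply Rinv_0_lt_compat; lra).
      split; [nra|]. unfold Rdiv at 2. apply Rmult_le_compat_l; [lra|].
      apply Rinv_le_contravar; lra. }
    assert (Hxy : y * y - c * x * y <= 2 * (x * x + y * y)).
    { destruct (Rabs_lt_between c 1) as [Hab _]; specialize (Hab Hc).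
      assert (- c * x * y <= x * x + y * y).
      { assert (0 <= (2 + c) * Rsqr (x + y)) by (apply Rmult_le_pos; [lra|apply Rle_0_sqr]).
        assert (0 <= (2 - c) * Rsqr (x - y)) by (apply Rmult_le_pos; [lra|apply Rle_0_sqr]).
        unfold Rsqr in *; nra. }
      nra. }
    assert (H0 : 0 <= x * x + y * y) by nra.
    assert (Hsum : 2 * (x * x + y * y) <= 2 / eta * S_ n).
    { apply (Rmult_le_reg_l eta); [lra|].
      replace (eta * (2 / eta * S_ n)) with (2 * S_ n) by (field; lra).
      assert (0 <= e n * S_ n) by nra. nra. }
    assert (Hk : 3 / (INR n + 2) / (INR n + 2) * (2 / eta) <= (1 / 2) / (INR n + 2)).
    { replace (3 / (INR n + 2) / (INR n + 2) * (2 / eta))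
        with (6 / (eta * (INR n + 2)) * / (INR n + 2)) by (field; lra).
      unfold Rdiv at 2. apply Rmult_le_compat_r.
      - left; apply Rinv_0_lt_compat; lra.
      - apply Rle_div_l; lra. }
    rewrite Hdiff.
    apply Rle_trans with ((1 - e n) * S_ n + (1 / 2) / (INR n + 2) * S_ n).
    - apply Rplus_le_compat_l.
      apply Rle_trans with ((e n - e (S n)) * (2 / eta * S_ n)).
      + apply Rmult_le_compat_l; lra.
      + rewrite <- Rmult_assoc. apply Rmult_le_compat_r; [lra|].
        apply Rle_trans with (2 := Hk). apply Rmult_le_compat_r; [|lra].
        left; apply Rdiv_lt_0_compat; lra.
    - unfold e. right; field; lra. }
  (* Only from [N] on is [S_ n] known to be nonnegative; the earlier terms are set to 0. *)
  assert (Hraabe : ex_series (fun n => if Compare_dec.le_dec N n then sqrt (S_ n) else 0)).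
  { apply (raabe_summable _ N).
    - intro n; destruct (Compare_dec.le_dec N n); [apply sqrt_pos|lra].
    - intros n Hn. destruct (Compare_dec.le_dec N (S n)); [|lia]. destruct (Compare_dec.le_dec N n); [|lia].
      pose proof (pos_INR n).
      apply Rsqr_incr_0_var; [|apply Rmult_le_pos; [lra|apply sqrt_pos]].
      rewrite !Rsqr_mult, !Rsqr_sqrt by (apply HS0; lia).
      specialize (Hstep n Hn); specialize (HS0 n Hn).
      apply (Rmult_le_compat_l ((INR n + 2) * (INR n + 2))) in Hstep; [|nra].
      unfold Rsqr. apply Rle_trans with (1 := Hstep).
      replace ((INR n + 2) * (INR n + 2) * ((1 - 5 / 2 / (INR n + 2)) * S_ n))
        with ((INR n + 2) * (INR n - 1 / 2) * S_ n) by (field; lra).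
      apply Rmult_le_compat_r; nra. }
  assert (Hs : ex_series (fun k => Rabs (d (N + k)%nat))).
  { apply (@ex_series_le R_AbsRing R_CompleteNormedModule _
             (fun k => / sqrt eta * (if Compare_dec.le_dec N (N + k) then sqrt (S_ (N + k)%nat) else 0))).
    - intro k; unfold norm; simpl; unfold abs; simpl. rewrite Rabs_Rabsolu.
      destruct (Compare_dec.le_dec N (N + k)) as [Hn|]; [|lia].
      assert (0 < sqrt eta) by (apply sqrt_lt_R0; lra).
      apply (Rmult_le_reg_l (sqrt eta)); [lra|].
      rewrite <- Rmult_assoc, Rinv_r, Rmult_1_l by lra.
      rewrite <- (sqrt_Rsqr_abs (d (N + k)%nat)), <- sqrt_mult by (try apply Rle_0_sqr; lra).
      apply sqrt_le_1_alt.
      specialize (Hpos (N + k)%nat (d (S (N + k))) (d (N + k)%nat) Hn).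
      unfold S_, Rsqr. nra.
    - apply (@ex_series_scal R_AbsRing R_NormedModule (/ sqrt eta)).
      destruct N as [|N']; [exact Hraabe|].
      exact (proj1 (ex_series_incr_n
        (fun n => if Compare_dec.le_dec (S N') n then sqrt (S_ n) else 0) (S N')) Hraabe). }
  destruct N as [|N]; [exact Hs|].
  apply (ex_series_incr_n (fun n => Rabs (d n)) (S N)); exact Hs.
Qed.

Lemma finite_summable (d : nat -> R) (N : nat) :
  (forall n, (N <= n)%nat -> d n = 0) -> ex_series d.
Proof.
  intro H. assert (Hs : ex_series (fun k => d (N + k)%nat)).
  { exists 0. apply (is_series_ext (fun _ => 0)).
    - intro k; rewrite H by lia; reflexivity.
    - apply filterlim_ext with (fun _ : nat => 0).
      + intro n. rewrite sum_n_const. simpl; ring.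
      + apply filterlim_const. }
  destruct N as [|N]; [exact Hs|].
  apply (ex_series_incr_n d (S N)); exact Hs.
Qed.

(** * Evaluation of power series *)

Definition ps_summable (a : ps) : Prop :=
  ex_series (fun n => Rabs (fst (a n))) /\ ex_series (fun n => Rabs (snd (a n))).

Definition ps_sum (a : ps) : Cx := (Series (fun n => fst (a n)), Series (fun n => snd (a n))).

Lemma ps_summable_le (a b : ps) :
  ps_summable a ->
  (forall n, Rabs (fst (b n)) <= Rabs (fst (a n)) + Rabs (snd (a n))) ->
  (forall n, Rabs (snd (b n)) <= Rabs (fst (a n)) + Rabs (snd (a n))) ->
  ps_summable b.
Proof.
  intros [H1 H2] Hf Hs.
  pose proof (ex_series_plus _ _ H1 H2) as H.
  split; (eapply (@ex_series_le R_AbsRing R_CompleteNormedModule); [|exact H]);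
    intro n; unfold norm; simpl; unfold abs; simpl; rewrite Rabs_Rabsolu; [apply Hf|apply Hs].
Qed.

Lemma ps_summable_mul_unit (a w : ps) :
  ps_summable a -> (forall n, Cnorm2 (w n) <= 1) ->
  ps_summable (fun n => Cmul (w n) (a n)).
Proof.
  intros Ha Hw; apply (ps_summable_le a); [exact Ha| |];
    intro n; specialize (Hw n); destruct (w n) as [p q], (a n) as [x y];
    unfold Cnorm2 in Hw; simpl in *;
    assert (Rabs p <= 1) by (apply Rabs_le; nra);
    assert (Rabs q <= 1) by (apply Rabs_le; nra);
    pose proof (Rabs_pos x); pose proof (Rabs_pos y).
  - unfold Rminus. apply Rle_trans with (1 := Rabs_triang _ _).
    rewrite Rabs_Ropp, !Rabs_mult. nra.
  - apply Rle_trans with (1 := Rabs_triang _ _). rewrite !Rabs_mult. nra.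
Qed.

(** Rewrites the recursive product as finite real sums, the form required by the product theorem for
    absolutely convergent series. *)
Lemma ps_mul_components (a b : ps) (n : nat) :
  fst (ps_mul a b n) =
    sum_f_R0 (fun k => fst (a k) * fst (b (n - k)%nat)) n -
    sum_f_R0 (fun k => snd (a k) * snd (b (n - k)%nat)) n /\
  snd (ps_mul a b n) =
    sum_f_R0 (fun k => fst (a k) * snd (b (n - k)%nat)) n +
    sum_f_R0 (fun k => snd (a k) * fst (b (n - k)%nat)) n.
Proof.
  unfold ps_mul; revert a; induction n as [|n IH]; intro a; [simpl; split; ring|].
  destruct (IH (ps_tail a)) as [E1 E2].
  rewrite !(decomp_sum _ (S n)) by lia. cbn [ps_conv fst snd Cadd Nat.pred].
  rewrite E1, E2; unfold ps_tail. rewrite Nat.sub_0_r. simpl Nat.sub. split; unfold Cmul; simpl; ring.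
Qed.

Lemma ps_sum_mul (a b : ps) :
  ps_summable a -> ps_summable b ->
  ps_sum (ps_mul a b) = Cmul (ps_sum a) (ps_sum b).
Proof.
  intros [A1 A2] [B1 B2].
  assert (C : forall f g : nat -> R, ex_series (fun n => Rabs (f n)) ->
     ex_series (fun n => Rabs (g n)) ->
     is_series (fun n => sum_f_R0 (fun k => f k * g (n - k)%nat) n) (Series f * Series g)).
  { intros f g Hf Hg. apply is_series_mult; try assumption;
      apply Series_correct; now apply ex_series_Rabs. }
  unfold ps_sum at 1, Cmul. f_equal; apply is_series_unique.
  - eapply is_series_ext; [intro n; symmetry; apply ps_mul_components|].
    apply (is_series_minus (V := R_NormedModule)); now apply C.
  - eapply is_series_ext; [intro n; symmetry; apply ps_mul_components|].
    apply (is_series_plus (V := R_NormedModule)); now apply C.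
Qed.

(** The remainder estimate of the Weierstrass test, uniform over all sequences dominated by [p]. *)
Lemma Series_tail_bound (f p : nat -> R) (n : nat) :
  ex_series p -> (forall k, Rabs (f k) <= p k) ->
  Rabs (Series f - sum_n f n) <= Series p - sum_n p n.
Proof.
  intros Hp Hf.
  assert (Hfa : ex_series (fun k => Rabs (f k))).
  { apply (@ex_series_le R_AbsRing R_CompleteNormedModule) with (2 := Hp).
    intro k; unfold norm; simpl; unfold abs; simpl; rewrite Rabs_Rabsolu; apply Hf. }
  rewrite (Series_incr_n f (S n)), (Series_incr_n p (S n)) by (lia || assumption || now apply ex_series_Rabs).
  rewrite !sum_n_Reals; simpl Nat.pred.
  replace (sum_f_R0 f n + Series (fun k => f (S n + k)%nat) - sum_f_R0 f n)
    with (Series (fun k => f (S n + k)%nat)) by ring.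
  replace (sum_f_R0 p n + Series (fun k => p (S n + k)%nat) - sum_f_R0 p n)
    with (Series (fun k => p (S n + k)%nat)) by ring.
  apply Rle_trans with (Series (fun k => Rabs (f (S n + k)%nat))).
  - apply Series_Rabs. exact (proj1 (ex_series_incr_n (fun k => Rabs (f k)) (S n)) Hfa).
  - apply Series_le; [|exact (proj1 (ex_series_incr_n p (S n)) Hp)].
    intro k; split; [apply Rabs_pos|apply Hf].
Qed.

(** The variable is [cos x] so that the series converges, uniformly, on the whole line: [IVT] asks
    for continuity everywhere, not only on [[-1, 1]]. *)
Lemma Series_cos_continuity (p : nat -> R) :
  ex_series (fun n => Rabs (p n)) ->
  continuity (fun x => Series (fun n => p n * cos x ^ n)).
Proof.
  intros Hp x.
  assert (Hb : forall y n, Rabs (p n * cos y ^ n) <= Rabs (p n)).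
  { intros y n. rewrite Rabs_mult, <- RPow_abs.
    rewrite <- (Rmult_1_r (Rabs (p n))) at 2.
    apply Rmult_le_compat_l; [apply Rabs_pos|].
    rewrite <- (pow1 n). apply pow_incr. split; [apply Rabs_pos|].
    apply Rabs_le; pose proof (COS_bound y); lra. }
  apply (CVU_continuity (fun n y => sum_f_R0 (fun k => p k * cos y ^ k) n) _ x (mkposreal 1 Rlt_0_1)).
  - intros eps Heps.
    pose proof (Series_correct _ Hp) as Hc; apply is_series_Reals in Hc.
    destruct (Hc eps Heps) as [N HN].
    exists N; intros n y Hn _.
    pose proof (Series_tail_bound _ _ n Hp (Hb y)) as Ht; rewrite !sum_n_Reals in Ht.
    apply Rle_lt_trans with (1 := Ht).
    specialize (HN n Hn). unfold Rdist in HN.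
    apply Rabs_def2 in HN; lra.
  - intros n y _.
    apply (continuity_pt_finite_SF (fun k y => p k * cos y ^ k)); intros k _.
    apply continuity_pt_mult; [apply continuity_pt_const; now intros ? ?|].
    apply (continuity_pt_comp cos (fun r => r ^ k)); [apply continuity_cos|].
    apply derivable_continuous_pt, derivable_pt_pow.
  - unfold Boule; rewrite Rminus_diag, Rabs_R0; simpl; lra.
Qed.

Lemma ps_sum_finite (a : ps) :
  (forall n, a (S (S (S n))) = C0) ->
  ps_summable a /\ ps_sum a = Cadd (a 0%nat) (Cadd (a 1%nat) (a 2%nat)).
Proof.
  intro Ha.
  assert (H : forall f : Cx -> R, f C0 = 0 ->
            ex_series (fun n => f (a n)) /\
            Series (fun n => f (a n)) = f (a 0%nat) + (f (a 1%nat) + f (a 2%nat))).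
  { intros f Hf.
    assert (H0 : forall n, (3 <= n)%nat -> f (a n) = 0).
    { intros [|[|[|n]]] Hn; try lia. now rewrite Ha. }
    assert (Hex := finite_summable _ _ H0). split; [exact Hex|].
    rewrite (Series_incr_n _ 3) by (lia || exact Hex).
    (* The zero tail is written as [0 * 0] so that [Series_scal_l] evaluates it. *)
    rewrite (Series_ext _ (fun _ => 0 * 0)) by (intro; rewrite H0 by lia; ring).
    rewrite Series_scal_l; simpl; ring. }
  split.
  - split; [apply (H (fun z => Rabs (fst z)))|apply (H (fun z => Rabs (snd z)))];
      simpl; apply Rabs_R0.
  - unfold ps_sum. rewrite (proj2 (H fst eq_refl)), (proj2 (H snd eq_refl)). reflexivity.
Qed.

Lemma ps_sum_scal (w : Cx) (a : ps) :
  ps_summable a -> ps_sum (fun n => Cmul w (a n)) = Cmul w (ps_sum a).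
Proof.
  intro Ha.
  destruct (ps_sum_finite (ps_const w)) as [Hw Ew]; [reflexivity|].
  replace (fun n => Cmul w (a n)) with (ps_mul (ps_const w) a)
    by (apply functional_extensionality; intro n; apply ps_const_mul).
  rewrite (ps_sum_mul _ _ Hw Ha), Ew; simpl; ring.
Qed.

(** * The square root of [1 - 2 c X + X^2] *)

Lemma ps_theta_add (a b : ps) : ps_theta (ps_add a b) = ps_add (ps_theta a) (ps_theta b).
Proof. apply functional_extensionality; intro n; unfold ps_theta, ps_add; ring. Qed.

Lemma ps_theta_sub (a b : ps) : ps_theta (ps_sub a b) = ps_sub (ps_theta a) (ps_theta b).
Proof. apply functional_extensionality; intro n; unfold ps_theta, ps_sub; ring. Qed.

Lemma ps_theta_const (c : Cx) : ps_theta (ps_const c) = ps_const C0.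
Proof.
  apply functional_extensionality; intros [|n]; unfold ps_theta; simpl;
    [change (RtoC 0) with C0|]; ring.
Qed.

Lemma ps_theta_X : ps_theta ps_X = ps_X.
Proof.
  apply functional_extensionality; intros [|[|n]]; unfold ps_theta; cbn [ps_X]; try ring.
  change (RtoC (INR 1)) with C1; ring.
Qed.

Definition disc (c : R) : ps :=
  (#C1 - (#C1 + #C1) * #(RtoC c) * ps_X + ps_X * ps_X)%ps.

Lemma disc_coef (c : R) (n : nat) :
  disc c n = match n with O => C1 | 1 => RtoC (- 2 * c) | 2 => C1 | _ => C0 end.
Proof.
  unfold disc.
  replace (#C1 - (#C1 + #C1) * #(RtoC c) * ps_X + ps_X * ps_X)%ps
    with (#C1 - (ps_X * #(RtoC c) + ps_X * #(RtoC c)) + ps_X * ps_X)%ps by ring.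
  unfold ps_add, ps_sub.
  destruct n as [|n]; [rewrite !ps_X_mul_0; simpl; ring|].
  rewrite !ps_X_mul_S. destruct n as [|[|n]]; simpl; try ring.
  unfold RtoC; Ccomp; f_equal; ring.
Qed.

(* From [F^2 = D]: [2 D (X F') = 2 F^2 (X F') = F (X D')]. *)
Lemma sqrt_disc_ode (c : R) (F : ps) :
  (F * F = disc c)%ps ->
  (ps_theta F - ps_X * ((#C1 + #C1) * #(RtoC c) * ps_theta F) + ps_X * (ps_X * ps_theta F)
   = ps_X * (ps_X * F - #(RtoC c) * F))%ps.
Proof.
  intro H.
  assert (Ht := f_equal ps_theta H). rewrite ps_theta_mul in Ht. unfold disc in Ht.
  rewrite ps_theta_add, ps_theta_sub, !ps_theta_mul, ps_theta_add, !ps_theta_const, ps_theta_X in Ht.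
  apply (ps_const_mul_cancel (Cadd C1 C1)); [unfold Cnorm2, C1; simpl; lra|].
  rewrite ps_const_Cadd.
  transitivity (disc c * (ps_theta F + ps_theta F))%ps; [unfold disc; ring|].
  rewrite <- H.
  transitivity (F * (ps_theta F * F + F * ps_theta F))%ps; [ring|].
  rewrite Ht; ring.
Qed.

(** Coefficients of the differential equation. They are real, so the recurrence holds for real and
    imaginary parts separately; [f] is either projection. *)
Lemma sqrt_disc_recurrence (c : R) (F : ps) (f : Cx -> R) :
  f = fst \/ f = snd -> (F * F = disc c)%ps ->
  f (F 1%nat) = - c * f (F O) /\
  forall n : nat, (INR n + 2) * f (F (n + 2)%nat)
    = c * (2 * INR n + 1) * f (F (n + 1)%nat) - (INR n - 1) * f (F n).
Proof.
  intros Hf H; apply sqrt_disc_ode in H.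
  assert (E : forall n z, f (Cmul (RtoC (INR n)) z) = INR n * f z).
  { intros n [x y]; destruct Hf as [-> | ->]; unfold Cmul, RtoC; simpl; ring. }
  split.
  - assert (H1 := f_equal (fun s => f (s 1%nat)) H). cbv beta in H1.
    unfold ps_add at 1, ps_sub at 1 in H1. rewrite !ps_X_mul_S, ps_X_mul_0 in H1.
    unfold ps_sub in H1. rewrite ps_X_mul_0 in H1.
    replace ((#C1 + #C1) * #(RtoC c) * ps_theta F)%ps
      with (#(RtoC c) * (ps_theta F + ps_theta F))%ps in H1 by ring.
    rewrite !ps_const_mul in H1. unfold ps_add, ps_theta in H1.
    generalize dependent H1; generalize (F O) (F 1%nat); intros [x y] [x' y'].
    destruct Hf as [-> | ->]; simpl; unfold RtoC, C0; simpl; lra.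
  - intro n.
    assert (H1 := f_equal (fun s => f (s (n + 2)%nat)) H). cbv beta in H1.
    replace (n + 2)%nat with (S (S n)) in * by lia.
    replace (n + 1)%nat with (S n) in * by lia.
    unfold ps_add at 1, ps_sub at 1 in H1. rewrite !ps_X_mul_S in H1.
    unfold ps_sub in H1. rewrite ps_X_mul_S in H1.
    replace ((#C1 + #C1) * #(RtoC c) * ps_theta F)%ps
      with (#(RtoC c) * (ps_theta F + ps_theta F))%ps in H1 by ring.
    rewrite !ps_const_mul in H1. unfold ps_add, ps_theta in H1.
    rewrite !S_INR in H1.
    generalize dependent H1. generalize (F n) (F (S n)) (F (S (S n))).
    intros [x y] [x' y'] [x'' y''].
    destruct Hf as [-> | ->]; simpl; unfold RtoC, C0; simpl; lra.
Qed.

Lemma sqrt_disc_summable (c : R) (F : ps) :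
  -1 < c <= 1 -> (F * F = disc c)%ps -> ps_summable F.
Proof.
  intros Hc H.
  assert (HH : forall f, f = fst \/ f = snd -> ex_series (fun n => Rabs (f (F n)))).
  { intros f Hf; destruct (sqrt_disc_recurrence c F f Hf H) as [H1 Hr].
    (* At [c = 1] the form used for the recurrence degenerates, but [D = (1 - X)^2] and the
       coefficients of its root vanish from degree 2 on. *)
    destruct (Req_dec c 1) as [->|Hc1].
    - apply (finite_summable _ 2).
      assert (Hz : forall n, f (F (n + 2)%nat) = 0 /\ f (F (n + 3)%nat) = 0).
      { induction n as [|n [IH1 IH2]].
        - pose proof (Hr O) as H2; pose proof (Hr 1%nat) as H3; simpl in *. lra.
        - pose proof (Hr (n + 2)%nat) as H3.
          replace (n + 2 + 1)%nat with (n + 3)%nat in H3 by lia.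
          replace (n + 2 + 2)%nat with (S n + 3)%nat in H3 by lia.
          replace (S n + 2)%nat with (n + 3)%nat by lia.
          split; [exact IH2|]. rewrite IH1, IH2 in H3.
          pose proof (pos_INR (n + 2)).
          apply (Rmult_eq_reg_l (INR (n + 2) + 2)); lra. }
      intros n Hn. replace n with (n - 2 + 2)%nat by lia.
      rewrite (proj1 (Hz _)); apply Rabs_R0.
    - apply (recurrence_summable c (fun n => f (F n))).
      + apply Rabs_def1; lra.
      + intro n; specialize (Hr n).
        replace (n + 2)%nat with (S (S n)) in Hr by lia.
        replace (n + 1)%nat with (S n) in Hr by lia. exact Hr. }
  split; apply HH; auto.
Qed.

(** Summability of the coefficients allows evaluation on the closed disc, boundary included, where
    multiplicativity carries over [F * F = D]. *)
Lemma sqrt_disc_eval (c : R) (F : ps) (y : Cx) :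
  -1 < c <= 1 -> (F * F = disc c)%ps -> Cnorm2 y <= 1 ->
  let s := fun n => Cmul (Cpow y n) (F n) in
  ps_summable s /\
  Cmul (ps_sum s) (ps_sum s)
  = Cadd (Csub C1 (Cmul (RtoC (2 * c)) y)) (Cmul y y).
Proof.
  intros Hc H Hy s.
  assert (Hs : ps_summable s).
  { apply ps_summable_mul_unit; [now apply (sqrt_disc_summable c)|].
    intro n; rewrite Cnorm2_pow, <- (pow1 n). apply pow_incr.
    split; [apply Cnorm2_nonneg|exact Hy]. }
  split; [exact Hs|].
  rewrite <- ps_sum_mul by exact Hs.
  replace (s * s)%ps with (fun n => Cmul (Cpow y n) (disc c n)).
  - rewrite (proj2 (ps_sum_finite (fun n => Cmul (Cpow y n) (disc c n)) ltac:(intro n; cbv beta; rewrite disc_coef; ring))).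
    rewrite !disc_coef; simpl. clear. unfold RtoC; Ccomp; f_equal; ring.
  - apply functional_extensionality; intro n. rewrite <- H.
    unfold ps_mul, s. now rewrite ps_conv_geom.
Qed.

(* With [v^2] on the unit circle and [r < 1], [D(r v^2) / v^2] is never a
   non-positive real, so the real part of its root keeps the sign it has at [r = 0]. *)
Lemma sqrt_disc_boundary_sign (c p q : R) (F : ps) :
  -1 < c <= 1 -> (F * F = disc c)%ps -> F O = C1 ->
  0 < p -> p * p + q * q = 1 ->
  let v := (p, q) : Cx in
  0 <= fst (Cmul (Cconj v) (ps_sum (fun n => Cmul (Cpow (Cmul v v) n) (F n)))).
Proof.
  intros Hc H HF0 Hp Hpq v.
  assert (Hv : Cnorm2 v = 1) by exact Hpq.
  (* Coefficients, in the radius [r], of the real part of [conj v] times the root at [r v^2]. *)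
  set (P := fun n => fst (Cmul (Cmul (Cconj v) (Cpow (Cmul v v) n)) (F n))).
  assert (HP : ex_series (fun n => Rabs (P n))).
  { apply (ps_summable_mul_unit F (fun n => Cmul (Cconj v) (Cpow (Cmul v v) n))).
    - now apply (sqrt_disc_summable c).
    - intro n; rewrite Cnorm2_mul, Cnorm2_pow, Cnorm2_mul, Cnorm2_conj, Hv, Rmult_1_l, Rmult_1_l, pow1. lra. }
  set (T := fun r : R => Cmul (Cconj v)
        (ps_sum (fun n => Cmul (Cpow (Cmul (RtoC r) (Cmul v v)) n) (F n)))).
  assert (Hy : forall r, -1 <= r <= 1 -> Cnorm2 (Cmul (RtoC r) (Cmul v v)) <= 1).
  { intros r Hr; rewrite !Cnorm2_mul, Hv; unfold Cnorm2, RtoC; simpl; nra. }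
  assert (HT : forall r, -1 <= r <= 1 -> fst (T r) = Series (fun n => P n * r ^ n)).
  { intros r Hr; unfold T.
    rewrite <- ps_sum_scal by apply (sqrt_disc_eval c F _ Hc H (Hy r Hr)).
    unfold ps_sum; cbn [fst]. apply Series_ext; intro n; unfold P.
    rewrite Cpow_mul.
    replace (Cpow (RtoC r) n) with (RtoC (r ^ n)).
    - generalize (Cpow (Cmul v v) n) (F n) (r ^ n); clearbody v; clear.
      intros; Ccomp; ring.
    - induction n as [|n IH]; simpl; [reflexivity|]. rewrite <- IH.
      unfold RtoC, Cmul; simpl; f_equal; ring. }
  (* Real and imaginary parts of [(T r)^2 = (conj v)^2 - 2 c r + r^2 v^2]. *)
  assert (HT2 : forall r, -1 <= r <= 1 ->
     fst (T r) * fst (T r) - snd (T r) * snd (T r) = (1 + r * r) * (p * p - q * q) - 2 * c * r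
     /\ 2 * fst (T r) * snd (T r) = (r * r - 1) * (2 * p * q)).
  { intros r Hr.
    destruct (sqrt_disc_eval c F _ Hc H (Hy r Hr)) as [_ E].
    assert (E2 : Cmul (T r) (T r) = Cmul (Cmul (Cconj v) (Cconj v))
       (Cadd (Csub C1 (Cmul (RtoC (2 * c)) (Cmul (RtoC r) (Cmul v v))))
          (Cmul (Cmul (RtoC r) (Cmul v v)) (Cmul (RtoC r) (Cmul v v))))).
    { rewrite <- E; unfold T; ring. }
    assert (Ev : Cmul v (Cconj v) = C1) by (rewrite Cmul_conj, Hv; reflexivity).
    assert (E3 : Cmul (T r) (T r) =
      Cadd (Csub (Cmul (Cconj v) (Cconj v)) (Cmul (RtoC (2 * c)) (RtoC r)))
        (Cmul (Cmul (RtoC r) (RtoC r)) (Cmul v v))).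
    { rewrite E2.
      transitivity (Cadd (Csub (Cmul (Cconj v) (Cconj v))
         (Cmul (Cmul (RtoC (2 * c)) (RtoC r)) (Cmul (Cmul v (Cconj v)) (Cmul v (Cconj v)))))
        (Cmul (Cmul (Cmul (RtoC r) (RtoC r)) (Cmul v v)) (Cmul (Cmul v (Cconj v)) (Cmul v (Cconj v)))));
        [ring|]. rewrite Ev; ring. }
    assert (F1 := f_equal fst E3); assert (F2 := f_equal snd E3).
    clear - F1 F2 Hpq. destruct (T r) as [x y]. unfold v in *.
    unfold Cadd, Csub, Copp, Cmul, RtoC, Cconj in F1, F2; simpl in *. split; nra. }
  (* The radius runs as [r = cos x], from the centre at [x = PI / 2] to the circle at [x = 0]. *)
  set (h := fun x => Series (fun n => P n * cos x ^ n)).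
  assert (Hh : forall x, h x = fst (T (cos x))) by (intro x; symmetry; apply HT, COS_bound).
  replace (fst _) with (h 0).
  2:{ rewrite Hh, cos_0; unfold T. do 4 f_equal. apply functional_extensionality; intro n.
      do 2 f_equal. change (RtoC 1) with C1; ring. }
  destruct (Rle_dec 0 (h 0)) as [|Hneg]; [assumption|exfalso].
  assert (Hpi : 0 < h (PI / 2)).
  { rewrite Hh, cos_PI2. unfold T. rewrite <- ps_sum_scal by apply (sqrt_disc_eval c F _ Hc H (Hy 0 ltac:(lra))).
    match goal with |- context [ps_sum ?a] => rewrite (proj2 (ps_sum_finite a
      ltac:(intro n; cbn [Cpow]; change (RtoC 0) with C0; ring))) end.
    rewrite HF0; simpl; lra. }
  destruct (IVT h 0 (PI / 2)) as [x [[Hx1 Hx2] Hx]].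
  - apply Series_cos_continuity; exact HP.
  - pose proof PI_RGT_0; lra.
  - lra.
  - exact Hpi.
  - assert (Hx0 : 0 < x) by (destruct (Req_dec x 0) as [->|]; lra).
    assert (Hr : 0 <= cos x < 1).
    { split; [apply cos_ge_0; pose proof PI_RGT_0; lra|].
      rewrite <- cos_0; apply cos_decreasing_1; pose proof PI_RGT_0; lra. }
    rewrite Hh in Hx. destruct (HT2 (cos x) ltac:(lra)) as [F1 F2].
    rewrite Hx in F1, F2. set (r := cos x) in *.
    (* If the real part vanishes at some [r < 1], the imaginary part of the square forces [v = 1].
       Then minus a square equals [1 - 2 c r + r^2 >= (1 - r)^2 > 0], which is absurd. *)
    assert (Hq : q = 0).
    { assert (E : (1 - r * r) * (p * q) = 0) by lra.
      apply Rmult_integral in E; destruct E as [E|E]; [nra|].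
      apply Rmult_integral in E; destruct E; lra. }
    subst q. assert (p = 1) by nra. subst p. nra.
Qed.

(** On the circle [D(v^2) / v^2] is the real number [tau^2], so [conj v] times the root is [tau] or
    [- tau]; the sign lemma decides. *)
Lemma sqrt_disc_boundary (c p q tau : R) (F : ps) :
  -1 < c <= 1 -> (F * F = disc c)%ps -> F O = C1 ->
  0 < p -> p * p + q * q = 1 ->
  0 <= tau -> tau * tau = 2 * (p * p - q * q) - 2 * c ->
  let v := (p, q) : Cx in
  ps_sum (fun n => Cmul (Cpow (Cmul v v) n) (F n)) = Cmul (RtoC tau) v.
Proof.
  intros Hc H HF0 Hp Hpq Ht Htau v.
  pose proof (sqrt_disc_boundary_sign c p q F Hc H HF0 Hp Hpq) as Hsg. fold v in Hsg. cbv zeta in Hsg.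
  assert (Hv : Cnorm2 v = 1) by exact Hpq.
  destruct (sqrt_disc_eval c F (Cmul v v) Hc H) as [_ E].
  { rewrite Cnorm2_mul, Hv; lra. }
  set (Z := ps_sum _) in *.
  assert (HZ : Z = Cmul (Cmul (Cconj v) Z) v).
  { transitivity (Cmul (Cmul v (Cconj v)) Z); [rewrite Cmul_conj, Hv; change (RtoC 1) with C1|]; ring. }
  rewrite HZ. f_equal.
  assert (E2 : Cmul (Cmul (Cconj v) Z) (Cmul (Cconj v) Z) = RtoC (tau * tau)).
  { transitivity (Cmul (Cmul (Cconj v) (Cconj v)) (Cmul Z Z)); [ring|].
    rewrite E, Htau.
    transitivity (Cadd (Csub (Cmul (Cconj v) (Cconj v))
        (Cmul (RtoC (2 * c)) (Cmul (Cmul v (Cconj v)) (Cmul v (Cconj v)))))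
        (Cmul (Cmul v v) (Cmul (Cmul v (Cconj v)) (Cmul v (Cconj v))))); [ring|].
    rewrite Cmul_conj, Hv; unfold v; Ccomp; f_equal; ring. }
  destruct (Cmul (Cconj v) Z) as [x y]. cbn [fst] in Hsg.
  assert (F1 := f_equal fst E2); assert (F2 := f_equal snd E2).
  unfold Cmul, RtoC in F1, F2; simpl in F1, F2.
  assert (Hxy : x * y = 0) by lra.
  apply Rmult_integral in Hxy.
  assert (Hy0 : y = 0) by (destruct Hxy; [subst x; nra|assumption]).
  subst y. unfold RtoC; f_equal. nra.
Qed.

(** * Limits of complex sequences *)

Definition vanishes (f : nat -> Cx) : Prop := is_lim_seq (fun t => Cnorm2 (f t)) 0.

Lemma vanishes_le (f : nat -> Cx) (e : nat -> R) :
  (forall t, Cnorm2 (f t) <= e t) -> is_lim_seq e 0 -> vanishes f.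
Proof.
  intros H He; unfold vanishes.
  apply (is_lim_seq_le_le (fun _ => 0) _ e); [|apply is_lim_seq_const|exact He].
  intro t; split; [apply Cnorm2_nonneg|apply H].
Qed.

Lemma vanishes_ext (f g : nat -> Cx) :
  (forall t, f t = g t) -> vanishes f -> vanishes g.
Proof.
  intros H; apply is_lim_seq_ext; intro t; now rewrite H.
Qed.

Lemma vanishes_scal (w : Cx) (f : nat -> Cx) : vanishes f -> vanishes (fun t => Cmul w (f t)).
Proof.
  intro H. apply (vanishes_le _ (fun t => Cnorm2 w * Cnorm2 (f t))).
  - intro t; rewrite Cnorm2_mul; lra.
  - replace 0 with (Cnorm2 w * 0) by ring.
    apply (is_lim_seq_scal_l _ (Cnorm2 w) 0); exact H.
Qed.

Lemma vanishes_add (f g : nat -> Cx) :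
  vanishes f -> vanishes g -> vanishes (fun t => Cadd (f t) (g t)).
Proof.
  intros Hf Hg. apply (vanishes_le _ (fun t => 2 * (Cnorm2 (f t) + Cnorm2 (g t)))).
  - intro t; destruct (f t) as [x y], (g t) as [x' y']; unfold Cnorm2; simpl.
    pose proof (Rle_0_sqr (x - x')); pose proof (Rle_0_sqr (y - y')); unfold Rsqr in *; nra.
  - replace 0 with (2 * (0 + 0)) by ring.
    apply (is_lim_seq_scal_l _ 2 (0 + 0)). now apply is_lim_seq_plus'.
Qed.

(** With [E] the squared error, Cauchy-Schwarz bounds the difference by [E + 2 sqrt (E K)]. *)
Lemma Cnorm2_asymptotic (f g : nat -> Cx) (K : R) :
  vanishes (fun t => Csub (f t) (g t)) -> (forall t, Cnorm2 (g t) <= K) ->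
  is_lim_seq (fun t => Cnorm2 (f t) - Cnorm2 (g t)) 0.
Proof.
  intros H HK. apply is_lim_seq_abs_0.
  set (E := fun t => Cnorm2 (Csub (f t) (g t))).
  apply (is_lim_seq_le_le (fun _ => 0) _ (fun t => E t + 2 * sqrt (E t * K)));
    [|apply is_lim_seq_const|].
  - intro t; split; [apply Rabs_pos|].
    unfold E; specialize (HK t); destruct (f t) as [x y], (g t) as [x' y'].
    unfold Csub, Cadd, Copp, Cnorm2 in *; simpl in *.
    set (e1 := x + - x') in *; set (e2 := y + - y') in *.
    replace (x * x + y * y - (x' * x' + y' * y'))
      with ((e1 * e1 + e2 * e2) + 2 * (e1 * x' + e2 * y')) by (unfold e1, e2; ring).
    apply Rle_trans with (1 := Rabs_triang _ _).
    rewrite (Rabs_pos_eq (e1 * e1 + e2 * e2)) by nra.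
    rewrite Rabs_mult, (Rabs_pos_eq 2) by lra.
    apply Rplus_le_compat_l, Rmult_le_compat_l; [lra|].
    rewrite <- sqrt_Rsqr_abs; apply sqrt_le_1_alt.
    apply Rle_trans with ((e1 * e1 + e2 * e2) * (x' * x' + y' * y')).
    + pose proof (Rle_0_sqr (e1 * y' - e2 * x')); unfold Rsqr in *; nra.
    + apply Rmult_le_compat_l; nra.
  - replace 0 with (0 + 2 * sqrt (0 * K)) by (rewrite Rmult_0_l, sqrt_0; ring).
    apply is_lim_seq_plus'; [exact H|].
    apply (is_lim_seq_scal_l _ 2 (sqrt (0 * K))).
    apply (is_lim_seq_continuous sqrt).
    + apply continuity_pt_sqrt; rewrite Rmult_0_l; lra.
    + apply (is_lim_seq_scal_r _ K 0); exact H.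
Qed.

Lemma ps_partial_sums_vanish (a : ps) :
  ps_summable a ->
  vanishes (fun m => Csub (sum_n (fun k => fst (a k)) m, sum_n (fun k => snd (a k)) m) (ps_sum a)).
Proof.
  intros [H1 H2]. apply ex_series_Rabs, Series_correct in H1, H2.
  assert (D : forall u l, is_series u l -> is_lim_seq (fun m => (sum_n u m - l) * (sum_n u m - l)) 0).
  { intros u l Hu.
    assert (is_lim_seq (fun m => sum_n u m - l) 0).
    { replace 0 with (l - l) by ring.
      apply is_lim_seq_minus'; [exact Hu|apply is_lim_seq_const]. }
    replace 0 with (0 * 0) by ring. now apply is_lim_seq_mult'. }
  unfold vanishes. replace 0 with (0 + 0) by ring.
  apply is_lim_seq_plus'; [apply (D _ _ H1)|apply (D _ _ H2)].
Qed.

(** * The return amplitude *)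

(* [1 + b = n v] with [v = p + i q] on the unit circle; the pole of the
   generating function is at [v^2]. *)
Lemma quadratic_coef_limit (p q n : R) (al : ps) :
  0 < p -> p * p + q * q = 1 -> 0 < n < 2 * p ->
  let v := (p, q) : Cx in
  let b := Csub (Cmul (RtoC n) v) C1 in
  (al * (al - #C1) - ps_X * (al * (al - #C1)) - ps_X * #(Cconj b) * al * al
    + #b * (al - #C1) * (al - #C1) = #C0)%ps ->
  al O = C1 ->
  vanishes (fun k => Csub (Cmul (Cpow (Cmul v v) k) (al k))
                          (RtoC ((Rabs (n - p) + (n - p)) / n))).
Proof.
  intros Hp Hpq Hn v b H Hal0.
  assert (Hv : Cnorm2 v = 1) by exact Hpq.
  assert (Ev : Cmul v (Cconj v) = C1) by (rewrite Cmul_conj, Hv; reflexivity).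
  assert (Hb : Cnorm2 b = n * n - 2 * n * p + 1).
  { unfold b, v; Ccomp. transitivity (n * n * (p * p + q * q) - 2 * n * p + 1); [ring|].
    rewrite Hpq; ring. }
  set (c := 1 - 2 * Cnorm2 b).
  (* [n < 2 p] amounts to [|b| < 1], hence to [-1 < c]. *)
  assert (Hc : -1 < c <= 1).
  { pose proof (Cnorm2_nonneg b). unfold c; split; [|lra]. rewrite Hb; nra. }
  set (P := ((#C1 + #b) - ps_X * (#C1 + #(Cconj b)))%ps).
  (* Completing the square: [F] is the derivative of the quadratic in [al], so [F * F] is its
     discriminant. *)
  set (F := ((#C1 + #C1) * P * al - (#C1 + #b + #b - ps_X))%ps).
  assert (HF : (F * F = disc c)%ps).
  { unfold disc.
    replace (#(RtoC c))%ps with (#C1 - (#C1 + #C1) * (#b * #(Cconj b)))%ps.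
    - transitivity ((#C1 - (#C1 + #C1) * (#C1 - (#C1 + #C1) * (#b * #(Cconj b))) * ps_X + ps_X * ps_X)
        + (#C1 + #C1) * (#C1 + #C1) * P *
        (al * (al - #C1) - ps_X * (al * (al - #C1)) - ps_X * #(Cconj b) * al * al
         + #b * (al - #C1) * (al - #C1)))%ps.
      + unfold F, P; ring.
      + rewrite H; ring.
    - unfold c; rewrite <- !ps_const_Cmul, Cmul_conj, <- !ps_const_Cadd, <- ps_const_Cmul, <- ps_const_Csub.
      f_equal. clear. generalize (Cnorm2 b); intro. Ccomp; f_equal; ring. }
  assert (Fco : forall k, F k = Csub
      (Cmul (Cadd C1 C1) (Csub (Cmul (Cmul (RtoC n) v) (al k))
          (match k with O => C0 | S j => Cmul (Cmul (RtoC n) (Cconj v)) (al j) end)))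
      (match k with O => Csub (Cmul (Cadd C1 C1) (Cmul (RtoC n) v)) C1 | 1 => Copp C1 | _ => C0 end)).
  { intro k.
    replace F with (#(Cadd C1 C1) * (#(Cmul (RtoC n) v) * al - ps_X * (#(Cmul (RtoC n) (Cconj v)) * al))
       - (#(Csub (Cmul (Cadd C1 C1) (Cmul (RtoC n) v)) C1) - ps_X))%ps.
    - unfold ps_sub at 1. rewrite ps_const_mul. unfold ps_sub.
      destruct k as [|k]; rewrite ?ps_X_mul_0, ?ps_X_mul_S, ?ps_const_mul.
      + simpl; ring.
      + destruct k; simpl; ring.
    - unfold F, P.
      replace (Cmul (RtoC n) (Cconj v)) with (Cadd C1 (Cconj b)) by (unfold b; clear; Ccomp; f_equal; ring).
      replace (Cmul (RtoC n) v) with (Cadd C1 b) by (unfold b; ring).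
      rewrite ps_const_Csub, ps_const_Cmul, !ps_const_Cadd; ring. }
  assert (HF0 : F O = C1) by (rewrite Fco, Hal0; ring).
  set (y := Cmul v v).
  set (s := fun k => Cmul (Cpow y k) (F k)).
  assert (Hy : Cnorm2 y <= 1) by (unfold y; rewrite Cnorm2_mul, Hv; lra).
  destruct (sqrt_disc_eval c F y Hc HF Hy) as [Hs _]. fold s in Hs.
  assert (Hsum : ps_sum s = Cmul (RtoC (2 * Rabs (n - p))) v).
  { apply (sqrt_disc_boundary c p q); try assumption.
    - pose proof (Rabs_pos (n - p)); lra.
    - replace (2 * Rabs (n - p) * (2 * Rabs (n - p))) with (4 * (Rabs (n - p) ^ 2)) by ring.
      rewrite pow2_abs. unfold c; rewrite Hb.
      replace (q * q) with (1 - p * p) by lra. ring. }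
  set (sg := fun m => (sum_n (fun k => fst (s k)) m, sum_n (fun k => snd (s k)) m) : Cx).
  (* At the pole the linear factor [P] acts on coefficients as a difference, because
     [v^2 conj v = v]. The partial sums telescope and expose the single amplitude [al (S m)]. *)
  assert (Hsg : forall m, sg (S m) = Cadd
      (Cmul (Cmul (Cadd C1 C1) (Cmul (RtoC n) v)) (Csub (Cmul (Cpow y (S m)) (al (S m))) C1))
      (Cadd C1 (Cmul v v))).
  { assert (sgS : forall m, sg (S m) = Cadd (sg m) (s (S m))).
    { intro m; unfold sg; rewrite !sum_Sn; reflexivity. }
    assert (sS : forall m, s (S m) = Cadd (Cmul (Cmul (Cadd C1 C1) (Cmul (RtoC n) v))
        (Csub (Cmul (Cpow y (S m)) (al (S m))) (Cmul (Cpow y m) (al m))))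
        (match m with O => Cmul v v | _ => C0 end)).
    { intro m; unfold s; rewrite Fco.
      transitivity (Cadd (Cmul (Cmul (Cadd C1 C1) (RtoC n))
        (Csub (Cmul v (Cmul (Cpow y (S m)) (al (S m)))) (Cmul v (Cmul (Cmul v (Cconj v)) (Cmul (Cpow y m) (al m))))))
        (match m with O => Cmul v v | _ => C0 end)).
      - destruct m; simpl; unfold y; ring.
      - rewrite Ev; ring. }
    induction m as [|m IH].
    - rewrite sgS, sS, Hal0.
      replace (sg O) with C1.
      + simpl; ring.
      + unfold sg; rewrite !sum_O; unfold s; rewrite HF0; simpl. unfold C1, Cmul; simpl; f_equal; ring.
    - rewrite sgS, sS, IH; ring. }
  pose proof (ps_partial_sums_vanish s Hs) as Hlim. fold sg in Hlim.
  apply is_lim_seq_incr_1.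
  apply is_lim_seq_incr_1 in Hlim.
  apply (vanishes_ext (fun m => Cmul (Cmul (RtoC (/ (2 * n))) (Cconj v)) (Csub (sg (S m)) (ps_sum s)))).
  2:{ now apply vanishes_scal. }
  intro m; rewrite Hsg, Hsum.
  set (g := Cmul (Cpow y (S m)) (al (S m))).
  transitivity (Cadd (Cmul (RtoC (/ (2 * n))) (Cmul (Cmul (Cadd C1 C1) (RtoC n)) (Cmul (Cmul v (Cconj v)) (Csub g C1))))
     (Cmul (RtoC (/ (2 * n))) (Cadd (Cconj v) (Csub (Cmul (Cmul v (Cconj v)) v) (Cmul (Cmul v (Cconj v)) (RtoC (2 * Rabs (n - p)))))))).
  - ring.
  - rewrite Ev. clearbody g. unfold v. clear - Hn. Ccomp; f_equal; field; lra.
Qed.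

(** [A] is even and [X] enters the equation only through [u = Dl X^2], so the equation can be read
    in [u]; [q], the inverse of [Dl], makes [u] the new variable. *)
Lemma quadratic_even_part (A : ps) (b bb Dl q : Cx) :
  (forall n, A (S (2 * n)) = C0) -> Cmul q Dl = C1 ->
  let u := (#Dl * (ps_X * ps_X))%ps in
  ((#C1 - u) * A * (A - #C1) - u * #bb * A * A + #b * (A - #C1) * (A - #C1) = #C0)%ps ->
  let al := ps_even q A in
  (al * (al - #C1) - ps_X * (al * (al - #C1)) - ps_X * #bb * al * al
    + #b * (al - #C1) * (al - #C1) = #C0)%ps.
Proof.
  intros HA Hq u H al.
  assert (Eadd : forall f g, ps_even q (f + g)%ps = (ps_even q f + ps_even q g)%ps).
  { intros; apply functional_extensionality; intro; unfold ps_even, ps_add; ring. }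
  assert (Esub : forall f g, ps_even q (f - g)%ps = (ps_even q f - ps_even q g)%ps).
  { intros; apply functional_extensionality; intro; unfold ps_even, ps_sub; ring. }
  assert (Escal : forall k f, ps_even q (#k * f)%ps = (#k * ps_even q f)%ps).
  { intros; apply functional_extensionality; intro; unfold ps_even; rewrite !ps_const_mul; ring. }
  assert (Econst : forall k, ps_even q (#k)%ps = (#k)%ps).
  { intros; apply functional_extensionality; intros [|n]; unfold ps_even; simpl; ring. }
  assert (EX : forall f, ps_even q (ps_X * (ps_X * f))%ps = (#q * (ps_X * ps_even q f))%ps).
  { intros; apply functional_extensionality; intros [|n]; rewrite ps_const_mul; unfold ps_even at 1.
    - simpl (2 * 0)%nat; rewrite !ps_X_mul_0; ring.
    - replace (2 * S n)%nat with (S (S (2 * n))) by lia. rewrite !ps_X_mul_S.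
      unfold ps_even; simpl Cpow; ring. }
  (* Regrouped so that each [X^2] stands in front of its factor, as [EX] expects. *)
  assert (H' : (A * A - A - #Dl * (ps_X * (ps_X * (A * A - A))) - #(Cmul Dl bb) * (ps_X * (ps_X * (A * A)))
     + #b * (A * A - A - A + #C1) = #C0)%ps).
  { rewrite <- H, ps_const_Cmul; unfold u; ring. }
  apply (f_equal (ps_even q)) in H'.
  repeat rewrite ?Eadd, ?Esub, ?Escal, ?Econst, ?EX in H'.
  rewrite (ps_even_mul q A A HA) in H'. fold al in H'.
  rewrite <- H'.
  rewrite ps_const_Cmul.
  transitivity (al * al - al - #(Cmul q Dl) * (ps_X * (al * al - al))
     - #(Cmul q Dl) * #bb * (ps_X * (al * al)) + #b * (al * al - al - al + #C1))%ps.
  - rewrite Hq; ring.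
  - rewrite ps_const_Cmul; ring.
Qed.

(** * From the origin to every site *)

Lemma is_lim_seq_div2 (e : nat -> R) (l : R) :
  is_lim_seq e l -> is_lim_seq (fun t => e (Nat.div2 t)) l.
Proof.
  intro H. apply (is_lim_seq_subseq e l Nat.div2); [|exact H].
  intros P [N HN]. exists (2 * N)%nat. intros n Hn. apply HN.
  rewrite <- (Nat.div2_double N). now apply Nat.div2_le_mono.
Qed.

(** The coefficients of [w / (1 - mu X^2)], the polar part expected of the return series. *)
Definition parity_geom (w mu : Cx) : ps :=
  fun t => if Nat.even t then Cmul w (Cpow mu (Nat.div2 t)) else C0.

Lemma Cnorm2_parity_geom (w mu : Cx) (t : nat) :
  Cnorm2 mu = 1 ->
  Cnorm2 (parity_geom w mu t) = (1 + (-1) ^ t) / 2 * Cnorm2 w.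
Proof.
  intro Hmu; unfold parity_geom.
  rewrite (Nat.div2_odd t) at 3. rewrite <- Nat.negb_even.
  destruct (Nat.even t); simpl Nat.b2n.
  - rewrite Nat.add_0_r, pow_1_even, Cnorm2_mul, Cnorm2_pow, Hmu, pow1; lra.
  - rewrite Nat.add_1_r, pow_1_odd. unfold Cnorm2, C0; simpl; lra.
Qed.

(* [kappa] and [mu] make the claimed limits satisfy the step relations exactly; as
   [cLL] is invertible, these relations determine the amplitudes at the next site. *)
Lemma amp_asymptotic (cRR cLR cRL cLL : Cx) (gamma delta : R) (kappa mu w : Cx) :
  Cnorm2 cLL <> 0 ->
  let g := Cexpi gamma in
  Cadd (Cmul cRR g) (Cmul cRL kappa) = Cmul g kappa ->
  Csub mu (Cmul cLR g) = Cmul cLL kappa ->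
  let aR := ampR cRR cLR cRL cLL gamma delta in
  let aL := ampL cRR cLR cRL cLL gamma delta in
  vanishes (fun t => Csub (aL O t) (parity_geom w mu t)) ->
  forall x,
    vanishes (fun t => Csub (aR (S x) (t + S x)%nat)
                            (Cmul (Cmul g (Cpow kappa x)) (parity_geom w mu t))) /\
    vanishes (fun t => Csub (aL x (t + x)%nat) (Cmul (Cpow kappa x) (parity_geom w mu t))).
Proof.
  intros HLL g E1 E2 aR aL H0.
  set (G := parity_geom w mu) in *.
  assert (HG : forall t, G (S (S t)) = Cmul mu (G t)).
  { intro t; unfold G, parity_geom; simpl. destruct (Nat.even t); ring. }
  induction x as [|x [IHR IHL]].
  - split.
    + apply (vanishes_ext (fun t => Cmul g (Csub (aL O t) (G t)))).
      * intro t; unfold aR. rewrite Nat.add_1_r, ampR_1_S; fold g aL; simpl; ring.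
      * now apply vanishes_scal.
    + apply (vanishes_ext (fun t => Csub (aL O t) (G t))); [|exact H0].
      intro t; rewrite Nat.add_0_r; simpl; ring.
  (* The step relation for [L_x] is solved for [L_(x+1)]; it is read two time units later, which
     brings in the factor [mu]. *)
  - assert (HL : vanishes (fun t => Csub (aL (S x) (t + S x)%nat) (Cmul (Cpow kappa (S x)) (G t)))).
    { apply (vanishes_ext (fun t => Cmul (Cinv cLL) (Cadd
         (Csub (aL x (S (S t) + x)%nat) (Cmul (Cpow kappa x) (G (S (S t)))))
         (Cmul (Copp cLR) (Csub (aR (S x) (t + S x)%nat) (Cmul (Cmul g (Cpow kappa x)) (G t))))))).
      - intro t. replace (S (S t) + x)%nat with (S (t + S x)) by lia.
        unfold aL at 1; rewrite ampL_S; fold aR aL. rewrite HG.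
        transitivity (Csub (Cmul (Cmul cLL (Cinv cLL)) (aL (S x) (t + S x)%nat))
           (Cmul (Cinv cLL) (Cmul (Cmul (Csub mu (Cmul cLR g)) (Cpow kappa x)) (G t)))); [ring|].
        rewrite E2.
        transitivity (Cmul (Cmul cLL (Cinv cLL)) (Csub (aL (S x) (t + S x)%nat) (Cmul (Cpow kappa (S x)) (G t)))).
        + simpl Cpow; ring.
        + rewrite Cmul_inv_r by exact HLL; ring.
      - apply vanishes_scal, vanishes_add; [|now apply vanishes_scal].
        apply is_lim_seq_incr_1 in IHL. apply is_lim_seq_incr_1 in IHL. exact IHL. }
    split; [|exact HL].
    apply (vanishes_ext (fun t => Cadd
      (Cmul cRR (Csub (aR (S x) (t + S x)%nat) (Cmul (Cmul g (Cpow kappa x)) (G t))))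
      (Cmul cRL (Csub (aL (S x) (t + S x)%nat) (Cmul (Cpow kappa (S x)) (G t)))))).
    + intro t. replace (t + S (S x))%nat with (S (t + S x)) by lia.
      unfold aR at 2; rewrite ampR_SS_S; fold aR aL.
      transitivity (Csub (Cadd (Cmul cRR (aR (S x) (t + S x)%nat)) (Cmul cRL (aL (S x) (t + S x)%nat)))
        (Cmul (Cmul (Cadd (Cmul cRR g) (Cmul cRL kappa)) (Cpow kappa x)) (G t))).
      * simpl Cpow; ring.
      * rewrite E1; simpl Cpow; ring.
    + apply vanishes_add; now apply vanishes_scal.
Qed.

(** * The limiting distribution *)

Lemma probII_amp (cRR cLR cRL cLL : Cx) (gamma delta : R) (t x : nat) :
  probII cRR cLR cRL cLL gamma delta t x
  = match x with
    | O => Cnorm2 (ampL cRR cLR cRL cLL gamma delta O t)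
    | S _ => Cnorm2 (ampR cRR cLR cRL cLL gamma delta x t)
             + Cnorm2 (ampL cRR cLR cRL cLL gamma delta x t)
    end.
Proof.
  unfold probII, ampR, ampL. now destruct (psiII cRR cLR cRL cLL gamma delta t) as [pR pL].
Qed.

(** [(1 + sgn s) |s| = |s| + s], the form in which the value at the pole appears. *)
Lemma Mb_eq (b : Cx) :
  Cnorm2 (Cadd C1 b) <> 0 ->
  Mb b = (Rabs (Cnorm2 b + Cre b) + (Cnorm2 b + Cre b)) / Cnorm2 (Cadd C1 b).
Proof.
  intro HN; unfold Mb; set (s := Cnorm2 b + Cre b).
  set (N := Cnorm2 (Cadd C1 b)) in *.
  assert (HN0 : 0 <= N) by apply Cnorm2_nonneg.
  replace (Cmod (Cdiv (RtoC s) (Cmul (Cadd C1 b) (Cadd C1 b)))) with (Rabs s / N).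
  - unfold sgn. destruct (Rlt_dec 0 s) as [Hs|Hs]; [|destruct (Rlt_dec s 0) as [Hs'|Hs']].
    + rewrite Rabs_pos_eq by lra; field; exact HN.
    + rewrite Rabs_left by lra; field; exact HN.
    + replace s with 0 by lra. rewrite Rabs_R0; field; exact HN.
  - unfold Cmod, Cdiv. rewrite Cnorm2_mul.
    replace (Cnorm2 (RtoC s)) with (Rsqr s) by (unfold Cnorm2, RtoC, Rsqr; simpl; ring).
    replace (Cnorm2 (Cinv (Cmul (Cadd C1 b) (Cadd C1 b)))) with (Rsqr (/ N)).
    + rewrite <- Rsqr_mult, sqrt_Rsqr_abs, Rabs_mult.
      rewrite (Rabs_pos_eq (/ N)); [reflexivity|].
      left; apply Rinv_0_lt_compat; lra.
    + assert (HNN : Cnorm2 (Cmul (Cadd C1 b) (Cadd C1 b)) = N * N) by (now rewrite Cnorm2_mul).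
      apply (Rmult_eq_reg_l (N * N)); [|nra].
      rewrite <- HNN at 2. rewrite <- Cnorm2_mul, Cmul_inv_r by (rewrite HNN; nra).
      unfold Rsqr, Cnorm2 at 1, C1; simpl; field; exact HN.
Qed.

Theorem theorem2 (cRR cLR cRL cLL : Cx) (gamma delta : R) :
  unitary2 cRR cLR cRL cLL ->
  cRR <> C0 ->
  forall x : nat,
    Un_cv (fun t : nat =>
             probII cRR cLR cRL cLL gamma delta t x
             - limII (bII cRR cLR cRL cLL gamma) t x) 0.
Proof.
  intros HU HRR x. apply is_lim_seq_Reals.
  destruct (unitary2_cols _ _ _ _ HU) as (Hrow & HDl & HRL & HLL).
  set (Dl := detU cRR cLR cRL cLL) in *.
  set (g := Cexpi gamma). set (om := Cexpi delta).
  assert (Hg : Cmul g (Cconj g) = C1) by (rewrite Cmul_conj; unfold g; now rewrite Cnorm2_Cexpi).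
  assert (Hom : Cmul om (Cconj om) = C1) by (rewrite Cmul_conj; unfold om; now rewrite Cnorm2_Cexpi).
  assert (HDD : Cmul Dl (Cconj Dl) = C1) by (rewrite Cmul_conj, HDl; reflexivity).
  assert (HRR0 : Cnorm2 cRR <> 0) by (intro E; apply HRR, Cnorm2_eq0, E).
  assert (HLL0 : Cnorm2 cLL <> 0) by (rewrite HLL, Cnorm2_mul, HDl, Cnorm2_conj; lra).
  set (b := bII cRR cLR cRL cLL gamma).
  assert (Eb : b = Cmul (Cmul (Cconj cLR) Dl) (Cconj g)).
  { unfold b, bII, g, Cexpi, Cconj at 3; simpl. now rewrite cos_neg, sin_neg. }
  assert (Hbn : Cnorm2 b = Cnorm2 cLR).
  { rewrite Eb, !Cnorm2_mul, !Cnorm2_conj, HDl; unfold g; rewrite Cnorm2_Cexpi; ring. }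
  assert (Hb1 : Cnorm2 b < 1) by (pose proof (Cnorm2_nonneg cRR); lra).
  assert (EbRL : cRL = Copp (Cmul b g)).
  { rewrite Eb, HRL. transitivity (Copp (Cmul (Cmul Dl (Cconj cLR)) (Cmul g (Cconj g)))).
    - rewrite Hg; ring.
    - ring. }
  assert (EbLR : Cmul cLR g = Cmul Dl (Cconj b)).
  { rewrite Eb, !Cconj_mul.
    replace (Cconj (Cconj cLR)) with cLR by (clear; Ccomp; f_equal; ring).
    replace (Cconj (Cconj g)) with g by (clear; clearbody g; Ccomp; f_equal; ring).
    transitivity (Cmul (Cmul cLR g) (Cmul Dl (Cconj Dl))); [rewrite HDD|]; ring. }
  (* Polar form [1 + b = n v]. Since [|b| < 1], the point [1 + b] lies in the right half-plane and
     [n] and [p] are positive. *)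
  set (n := Cmod (Cadd C1 b)).
  assert (Hn2 : n * n = Cnorm2 (Cadd C1 b)) by (apply sqrt_sqrt, Cnorm2_nonneg).
  assert (HNpos : 0 < Cnorm2 (Cadd C1 b)).
  { clear - Hb1. destruct b as [bx by_]; unfold Cnorm2, Cadd, C1 in *; simpl in *.
    assert (-1 < bx) by nra. nra. }
  assert (Hn0 : 0 < n) by (apply sqrt_lt_R0; exact HNpos).
  set (p := (1 + fst b) / n). set (q := snd b / n).
  set (v := (p, q) : Cx).
  assert (Env : Cadd C1 b = Cmul (RtoC n) v).
  { unfold v, p, q. clear - Hn0. destruct b as [bx by_]. unfold Cadd, Cmul, RtoC, C1; simpl.
    f_equal; field; lra. }
  assert (Hpq : p * p + q * q = 1).
  { assert (E := f_equal Cnorm2 Env). rewrite <- Hn2, Cnorm2_mul in E.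
    unfold v, Cnorm2, RtoC in E; simpl in E. nra. }
  assert (Hp : 0 < p).
  { apply Rdiv_lt_0_compat; [|exact Hn0]. unfold Cnorm2 in Hb1. nra. }
  assert (Ebv : b = Csub (Cmul (RtoC n) v) C1) by (rewrite <- Env; ring).
  assert (Hbnp : Cnorm2 b = n * n - 2 * n * p + 1).
  { rewrite Ebv; unfold v; Ccomp.
    transitivity (n * n * (p * p + q * q) - 2 * n * p + 1); [ring|]. rewrite Hpq; ring. }
  assert (Hn2p : n < 2 * p) by nra.
  assert (Hv : Cnorm2 v = 1) by exact Hpq.
  assert (Evv : Cmul v (Cconj v) = C1) by (rewrite Cmul_conj, Hv; reflexivity).
  set (l := (Rabs (n - p) + (n - p)) / n).
  assert (HM : Mb b = l).
  { rewrite Mb_eq by lra. rewrite <- Hn2.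
    replace (Cnorm2 b + Cre b) with (n * (n - p)).
    - rewrite Rabs_mult, (Rabs_pos_eq n) by lra. unfold l; field; lra.
    - rewrite Hbnp. replace (Cre b) with (n * p - 1); [ring|].
      rewrite Ebv; unfold v, Cre, Csub, Cadd, Cmul, Copp, RtoC, C1; simpl; ring. }
  (* [kappa] is the ratio of the amplitudes at neighbouring sites, of modulus [nuII b]; [mu] is the
     inverse of the pole in [z^2]. *)
  set (kappa := Cmul cRR (Cinv (Cadd C1 b))).
  set (mu := Cmul Dl (Cmul (Cconj v) (Cconj v))).
  assert (Hmu : Cnorm2 mu = 1) by (unfold mu; rewrite !Cnorm2_mul, Cnorm2_conj, HDl, Hv; ring).
  assert (Ek : Cmul (Cadd C1 b) kappa = cRR).
  { unfold kappa. transitivity (Cmul cRR (Cmul (Cadd C1 b) (Cinv (Cadd C1 b)))); [ring|].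
    rewrite Cmul_inv_r by lra; ring. }
  assert (Hnu : nuII b ^ 2 = Cnorm2 kappa).
  { assert (E := f_equal Cnorm2 Ek). rewrite Cnorm2_mul, <- Hn2 in E.
    unfold nuII; fold n. unfold rho. apply (Rmult_eq_reg_l (n * n)); [|nra].
    rewrite E. transitivity (sqrt (1 - Cnorm2 b) * sqrt (1 - Cnorm2 b)); [field; lra|].
    rewrite sqrt_sqrt; lra. }
  assert (Hk0 : Cnorm2 kappa <> 0).
  { intro E0. assert (E := f_equal Cnorm2 Ek). rewrite Cnorm2_mul, E0 in E. lra. }
  set (w := Cmul (RtoC l) om).
  assert (Hw : Cnorm2 w = l ^ 2).
  { unfold w. rewrite Cnorm2_mul. unfold om; rewrite Cnorm2_Cexpi.
    unfold Cnorm2, RtoC; simpl; ring. }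
  set (aL := ampL cRR cLR cRL cLL gamma delta).
  set (aR := ampR cRR cLR cRL cLL gamma delta).
  assert (Hodd : forall k, aL O (S (2 * k)) = C0).
  { intro k; apply (amp_parity cRR cLR cRL cLL gamma delta _ _ k); lia. }
  (* Removing the initial phase normalises the constant coefficient to 1. *)
  set (A := (#(Cconj om) * aL O)%ps).
  assert (Hret : vanishes (fun k => Csub (Cmul (Cpow (Cmul v v) k) (ps_even (Cconj Dl) A k)) (RtoC l))).
  { apply (quadratic_coef_limit p q n); try assumption; [now split| |].
    - fold v. rewrite <- Ebv. apply (quadratic_even_part A b (Cconj b) Dl).
      + intro k; unfold A; rewrite ps_const_mul, Hodd; ring.
      + rewrite <- HDD; ring.
      + pose proof (ampL_0_quadratic cRR cLR cRL cLL gamma delta b (Cconj b) Dl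
                      HRR0 HLL0 eq_refl EbRL EbLR) as HQ.
        cbv zeta in HQ. fold om aL in HQ.
        assert (Ho1 : (#C1 = #(Cconj om) * #om)%ps).
        { rewrite <- ps_const_Cmul; f_equal; rewrite <- Hom; ring. }
        transitivity (#(Cconj om) * #(Cconj om) * #C0)%ps; [|ring].
        rewrite <- HQ. unfold A.
        replace (#(Cconj om) * aL O - #C1)%ps with (#(Cconj om) * (aL O - #om))%ps; [ring|].
        rewrite Ho1; ring.
    - unfold ps_even, A. simpl (2 * 0)%nat. rewrite ps_const_mul.
      change (aL O O) with om. simpl Cpow.
      transitivity (Cmul om (Cconj om)); [ring|exact Hom]. }
  assert (H0 : vanishes (fun t => Csub (aL O t) (parity_geom w mu t))).
  { apply (vanishes_le _ (fun t => Cnorm2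
      (Csub (Cmul (Cpow (Cmul v v) (Nat.div2 t)) (ps_even (Cconj Dl) A (Nat.div2 t))) (RtoC l)))).
    2:{ exact (is_lim_seq_div2 _ _ Hret). }
    intro t; unfold parity_geom. pose proof (Nat.div2_odd t) as Ht.
    rewrite <- Nat.negb_even in Ht. destruct (Nat.even t); simpl Nat.b2n in Ht.
    - rewrite Nat.add_0_r in Ht. set (k := Nat.div2 t) in *. rewrite Ht.
      right.
      (* Undoing the rescaling multiplies the error by the phase [om mu^k]. *)
      transitivity (Cnorm2 (Cmul om (Cpow mu k)) * Cnorm2 (Csub (Cmul (Cpow (Cmul v v) k) (ps_even (Cconj Dl) A k)) (RtoC l))).
      + rewrite <- Cnorm2_mul; f_equal. unfold ps_even, A, w; rewrite ps_const_mul.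
        transitivity (Csub (Cmul (Cmul om (Cconj om)) (Cmul (Cmul (Cmul (Cpow mu k) (Cpow (Cmul v v) k)) (Cpow (Cconj Dl) k)) (aL O (2 * k)%nat)))
          (Cmul (Cmul (RtoC l) om) (Cpow mu k))); [|ring].
        rewrite Hom, <- !Cpow_mul.
        replace (Cmul (Cmul mu (Cmul v v)) (Cconj Dl)) with C1.
        * assert (E1 : Cpow C1 k = C1) by (clear; induction k as [|k IH]; simpl; [|rewrite IH]; ring).
          rewrite E1; ring.
        * unfold mu. transitivity (Cmul (Cmul Dl (Cconj Dl)) (Cmul (Cmul v (Cconj v)) (Cmul v (Cconj v)))); [|ring].
          rewrite HDD, Evv; ring.
      + rewrite Cnorm2_mul, Cnorm2_pow, Hmu, pow1; unfold om; rewrite Cnorm2_Cexpi; ring.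
    - rewrite Ht, Nat.add_1_r, Hodd.
      replace (Cnorm2 (Csub C0 C0)) with 0 by (unfold Csub, Cadd, Copp, Cnorm2, C0; simpl; ring).
      apply Cnorm2_nonneg. }
  assert (Hasym := amp_asymptotic cRR cLR cRL cLL gamma delta kappa mu w HLL0).
  cbv zeta in Hasym. fold g aL aR in Hasym.
  specialize (Hasym ltac:(rewrite <- Ek, EbRL; ring)).
  (* Times [1 + b], both sides become [Dl |cRR|^2], as [(1 + b) (conj v)^2 = 1 + conj b]. *)
  assert (E2 : Csub mu (Cmul cLR g) = Cmul cLL kappa).
  { apply (Cmul_cancel_l (Cadd C1 b)); [lra|].
    transitivity (Cmul cLL (Cmul (Cadd C1 b) kappa)); [|ring].
    rewrite Ek, EbLR, HLL. unfold mu.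
    assert (Ec : Cmul (Cadd C1 b) (Cmul (Cconj v) (Cconj v)) = Cadd C1 (Cconj b)).
    { replace (Cadd C1 (Cconj b)) with (Cconj (Cadd C1 b)) by (clear; clearbody b; Ccomp; f_equal; ring).
      rewrite Env. transitivity (Cmul (Cmul v (Cconj v)) (Cmul (RtoC n) (Cconj v))); [ring|].
      rewrite Evv; clearbody v; clear; Ccomp; f_equal; ring. }
    transitivity (Cmul Dl (Csub (Cmul (Cadd C1 b) (Cmul (Cconj v) (Cconj v))) (Cmul (Cconj b) (Cadd C1 b)))); [ring|].
    rewrite Ec. transitivity (Cmul Dl (Csub C1 (Cmul b (Cconj b)))); [ring|].
    transitivity (Cmul Dl (Cmul cRR (Cconj cRR))); [|ring].
    f_equal. rewrite !Cmul_conj, Hbn. unfold RtoC, Csub, Cadd, Copp, C1; simpl; f_equal; lra. }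
  specialize (Hasym E2 H0).
  assert (HGle : forall k z t, Cnorm2 z = k -> Cnorm2 (Cmul z (parity_geom w mu t)) <= k * l ^ 2).
  { intros k z t <-. rewrite Cnorm2_mul, (Cnorm2_parity_geom _ _ _ Hmu), Hw.
    apply Rmult_le_compat_l; [apply Cnorm2_nonneg|].
    assert ((-1) ^ t <= 1).
    { apply Rle_trans with (1 := Rle_abs _). rewrite pow_1_abs; lra. }
    pose proof (pow2_ge_0 l). nra. }
  destruct x as [|x].
  - destruct (Hasym O) as [_ HL].
    apply Cnorm2_asymptotic with (K := 1 * l ^ 2) in HL.
    2:{ intro t; apply HGle. unfold Cnorm2; simpl; ring. }
    apply is_lim_seq_ext with (2 := HL). intro t.
    rewrite probII_amp; fold aL. rewrite Nat.add_0_r, Cnorm2_mul, (Cnorm2_parity_geom _ _ _ Hmu), Hw.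
    unfold limII. fold b. rewrite HM, pow2_abs. simpl Cpow. unfold C1, Cnorm2 at 2; simpl fst; simpl snd.
    simpl (0 + t)%nat. ring.
  - destruct (Hasym x) as [HR _]. destruct (Hasym (S x)) as [_ HL].
    (* At time [t + x + 1] both amplitudes at site [x + 1] follow [parity_geom w mu t], and site
       plus time has the parity of [t]. *)
    apply (is_lim_seq_incr_n _ (S x)).
    apply Cnorm2_asymptotic with (K := Cnorm2 (Cmul g (Cpow kappa x)) * l ^ 2) in HR;
      [|intro t; now apply HGle].
    apply Cnorm2_asymptotic with (K := Cnorm2 (Cpow kappa (S x)) * l ^ 2) in HL;
      [|intro t; now apply HGle].
    pose proof (is_lim_seq_plus' _ _ _ _ HR HL) as HH. rewrite Rplus_0_r in HH.
    apply is_lim_seq_ext with (2 := HH). intro t.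
    rewrite probII_amp; fold aR aL. rewrite !Cnorm2_mul, (Cnorm2_parity_geom _ _ _ Hmu), Hw, !Cnorm2_pow.
    unfold limII; fold b. rewrite HM, pow2_abs, pow_mult, Hnu.
    unfold g at 1; rewrite Cnorm2_Cexpi.
    replace ((-1) ^ (S x + (t + S x))) with ((-1) ^ t).
    (* [nu^(2x) (1 + nu^2) = nu^(2x+2) (1 + nu^(-2))], with [nu^2] the squared modulus of
       [kappa]. *)
    + simpl pow. field. exact Hk0.
    + replace (S x + (t + S x))%nat with (t + 2 * S x)%nat by lia.
      rewrite pow_add, pow_1_even; ring.
Qed.
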